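(* As an identity of formal power series in $q$, $$\sum_{\substack{r_1\geq r_2\geq r_3\geq 0\\ s_1\geq s_2\geq s_3\geq 0}} \frac{q^{r_1^2-r_1s_1+s_1^2+r_2^2-r_2s_2+s_2^2+r_3^2-r_3s_3+s_3^2+r_1+r_2+r_3+s_1+s_2+s_3}}{(q;q)_{r_1-r_2}(q;q)_{r_2-r_3}(q;q)_{r_3}(q;q)_{s_1-s_2}(q;q)_{s_2-s_3}(q;q)_{s_3}(q;q)_{r_3+s_3+1}} = \frac{1}{(q;q)_\infty}\,\frac{1}{\theta(q^{2},q^{3},q^{3},q^{4},q^{4},q^{5},q^{5},q^{6},q^{6};q^{13})},$$ where the sum runs over integers $r_1,r_2,r_3,s_1,s_2,s_3$ as indicated.
   Context: For an integer $L\ge 0$, $(a;q)_L:=(1-a)(1-aq)\cdots(1-aq^{L-1})$ and $(a;q)_\infty:=\lim_{L\to\infty}(a;q)_L$. The (modified) theta function is $\theta(a;q):=(a;q)_\infty(q/a;q)_\infty$, and $\theta(a_1,\dots,a_k;q):=\theta(a_1;q)\cdots\theta(a_k;q)$. In particular $\theta(q^i;q^{13})=(q^i;q^{13})_\infty(q^{13-i};q^{13})_\infty$. *)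

(* Defs.v *)
From HB Require Import structures.
From mathcomp Require Import all_boot all_order all_algebra.
From mathcomp Require Import boolp classical_sets.
Set Implicit Arguments.
Unset Strict Implicit.
Unset Printing Implicit Defensive.
Import GRing.Theory.
Local Open Scope ring_scope.

(* The ring R[[q]] of formal power series; [coef f n] is the coefficient of   *)
(* q^n in f.                                                                  *)
Record fps (R : Type) := Fps { coef : nat -> R }.

HB.instance Definition _ (R : Type) := gen_eqMixin (fps R).
HB.instance Definition _ (R : Type) := gen_choiceMixin (fps R).

Lemma fpsP (R : Type) (f g : fps R) : (forall n, coef f n = coef g n) -> f = g.
Proof. by case: f g => [f] [g] /= fg; congr Fps; apply: funext. Qed.

Section Zmodule.
Variable R : zmodType.
Implicit Types f g h : fps R.

Definition fps_zero : fps R := Fps (fun=> 0).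
Definition fps_opp f := Fps (fun n => - coef f n).
Definition fps_add f g := Fps (fun n => coef f n + coef g n).

Fact fps_addA : associative fps_add.
Proof. by move=> f g h; apply: fpsP => n /=; rewrite addrA. Qed.
Fact fps_addC : commutative fps_add.
Proof. by move=> f g; apply: fpsP => n /=; rewrite addrC. Qed.
Fact fps_add0 : left_id fps_zero fps_add.
Proof. by move=> f; apply: fpsP => n /=; rewrite add0r. Qed.
Fact fps_addN : left_inverse fps_zero fps_opp fps_add.
Proof. by move=> f; apply: fpsP => n /=; rewrite addNr. Qed.

HB.instance Definition _ :=
  GRing.isZmodule.Build (fps R) fps_addA fps_addC fps_add0 fps_addN.

Lemma coef_fps0 n : coef (0 : fps R) n = 0. Proof. by []. Qed.
Lemma coef_fpsN f n : coef (- f) n = - coef f n. Proof. by []. Qed.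
Lemma coef_fpsD f g n : coef (f + g) n = coef f n + coef g n.
Proof. by []. Qed.
Lemma coef_fpsB f g n : coef (f - g) n = coef f n - coef g n.
Proof. by []. Qed.
Lemma coef_fps_sum (I : Type) (r : seq I) (P : pred I) (F : I -> fps R) n :
  coef (\sum_(i <- r | P i) F i) n = \sum_(i <- r | P i) coef (F i) n.
Proof. by elim/big_rec2: _ => // i x f _ <-. Qed.

End Zmodule.

Section ComRing.
Variable R : comNzRingType.
Implicit Types f g h : fps R.

Definition fps_one : fps R := Fps (fun n => (n == 0%N)%:R).
Definition fps_mul f g :=
  Fps (fun n => \sum_(i < n.+1) coef f i * coef g (n - i)).

Let trunc N f := \poly_(i < N) coef f i.

Let coef_trunc N f n : (n < N)%N -> (trunc N f)`_n = coef f n.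
Proof. by move=> nN; rewrite coef_poly nN. Qed.

Let coef_mul N f g n :
  (n < N)%N -> coef (fps_mul f g) n = (trunc N f * trunc N g)`_n.
Proof.
move=> nN; rewrite coefM; apply: eq_bigr => i _.
have iN : (i < N)%N by apply: leq_trans nN; apply: ltn_ord.
by rewrite !coef_trunc // (leq_ltn_trans (leq_subr _ _) nN).
Qed.

Fact fps_mulC : commutative fps_mul.
Proof. by move=> f g; apply: fpsP => n; rewrite !(@coef_mul n.+1) // mulrC. Qed.

Fact fps_mulA : associative fps_mul.
Proof.
move=> f g h; apply: fpsP => n.
have leN (i : 'I_n.+1) : (n - i < n.+1)%N by rewrite ltnS leq_subr.
transitivity ((trunc n.+1 f * (trunc n.+1 g * trunc n.+1 h))`_n).
  rewrite coefM; apply: eq_bigr => i _.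
  by rewrite coef_trunc // -coef_mul.
rewrite mulrA coefM; apply: eq_bigr => i _.
by rewrite (@coef_trunc n.+1 h) // -coef_mul.
Qed.

Fact fps_mul1 : left_id fps_one fps_mul.
Proof.
move=> f; apply: fpsP => n /=.
by rewrite big_ord_recl /= mul1r subn0 big1 ?addr0 // => i _; rewrite mul0r.
Qed.

Fact fps_mulDl : left_distributive fps_mul +%R.
Proof.
move=> f g h; apply: fpsP => n /=.
by rewrite -big_split /=; apply: eq_bigr => i _; rewrite mulrDl.
Qed.

Fact fps_one_neq0 : fps_one != 0.
Proof.
apply/eqP => /(congr1 (fun f => coef f 0)) /= /eqP.
by rewrite (oner_eq0 R).
Qed.

HB.instance Definition _ := GRing.Zmodule_isComNzRing.Build (fps R)
  fps_mulA fps_mulC fps_mul1 fps_mulDl fps_one_neq0.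

Lemma coef_fps1 n : coef (1 : fps R) n = (n == 0%N)%:R. Proof. by []. Qed.
Lemma coef_fpsM f g n :
  coef (f * g) n = \sum_(i < n.+1) coef f i * coef g (n - i).
Proof. by []. Qed.

Definition fpsX : fps R := Fps (fun n => (n == 1%N)%:R).

Lemma coef_fpsMX f n : coef (f * fpsX) n = if n is m.+1 then coef f m else 0.
Proof.
rewrite mulrC coef_fpsM big_ord_recl mul0r add0r.
case: n => [|n]; first by rewrite big_ord0.
rewrite big_ord_recl /= mul1r subSS subn0 big1 ?addr0 // => i _.
by rewrite mul0r.
Qed.

Lemma coef_fpsXn k n : coef (fpsX ^+ k) n = (n == k)%:R.
Proof. by elim: k n => // k IHk [|n]; rewrite exprSr coef_fpsMX ?IHk. Qed.

Lemma coef_fpsX_small f k n :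
  coef f 0 = 0 -> (n < k)%N -> coef (f ^+ k) n = 0.
Proof.
move=> f0; elim: k n => // k IHk n nk.
rewrite exprS coef_fpsM big_ord_recl f0 mul0r add0r big1 // => i _.
rewrite IHk ?mulr0 // lift0 -ltnS (leq_trans _ nk) // ltnS.
by case: n i {nk} => [[] //|n i]; rewrite subSS ltnS leq_subr.
Qed.

End ComRing.

Arguments fpsX {R}.

Section UnitRing.
Variable R : comUnitRingType.
Implicit Types f g h : fps R.

Definition fps_unit : {pred fps R} := [pred f | coef f 0 \is a GRing.unit].

(* The first n.+1 coefficients of 1/f, from f * (1/f) = 1.                    *)
Fixpoint fps_inv_seq f n : seq R :=
  if n is m.+1 then
    let s := fps_inv_seq f m in
    rcons s (- (coef f 0)^-1 * \sum_(i < m.+1) coef f (m.+1 - i) * s`_i)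
  else [:: (coef f 0)^-1].

Definition fps_inv f :=
  if f \in fps_unit then Fps (fun n => (fps_inv_seq f n)`_n) else f.

Let size_inv_seq f n : size (fps_inv_seq f n) = n.+1.
Proof. by elim: n => //= n IHn; rewrite size_rcons IHn. Qed.

Let nth_inv_seq f n i :
  (i <= n)%N -> (fps_inv_seq f n)`_i = (fps_inv_seq f i)`_i.
Proof.
elim: n => [|n IHn]; first by case: i.
rewrite leq_eqVlt ltnS => /predU1P[-> //|le_in].
by rewrite /= nth_rcons size_inv_seq ltnS le_in IHn.
Qed.

Fact fps_mulVx : {in fps_unit, left_inverse 1 fps_inv *%R}.
Proof.
move=> f Uf; rewrite /fps_inv Uf; apply: fpsP => n.
rewrite coef_fpsM coef_fps1 big_ord_recr subnn /=.
case: n => [|n]; first by rewrite big_ord0 add0r mulVr.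
rewrite /= nth_rcons size_inv_seq ltnn eqxx mulrAC mulNr mulVr // mulN1r.
apply/eqP; rewrite subr_eq0; apply/eqP; apply: eq_bigr => i _.
by rewrite mulrC (@nth_inv_seq f n i) // -ltnS.
Qed.

Fact fps_unitPl f g : g * f = 1 -> fps_unit f.
Proof.
move=> /(congr1 (fun h => coef h 0)); rewrite coef_fpsM big_ord1 coef_fps1 => gf.
by apply/unitrPr; exists (coef g 0); rewrite mulrC.
Qed.

Fact fps_invr_out : {in [predC fps_unit], fps_inv =1 id}.
Proof. by move=> f /negPf Uf; rewrite /fps_inv Uf. Qed.

HB.instance Definition _ := GRing.ComNzRing_hasMulInverse.Build (fps R)
  fps_mulVx fps_unitPl fps_invr_out.

Lemma fps_unitE f : (f \is a GRing.unit) = (coef f 0 \is a GRing.unit).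
Proof. by []. Qed.

End UnitRing.

Arguments coef : simpl never.

Section Limits.
Variable R : comNzRingType.
Implicit Types f g : fps R.

(* Convergence in the q-adic topology: every coefficient is eventually        *)
(* constant.                                                                  *)
Definition fps_cvg (u : nat -> fps R) f :=
  forall n, exists N, forall k, (N <= k)%N -> coef (u k) n = coef f n.

Definition fps_lim (u : nat -> fps R) : fps R :=
  xget 0 [set f | fps_cvg u f]%classic.

Lemma fps_cvg_unique u f g : fps_cvg u f -> fps_cvg u g -> f = g.
Proof.
move=> uf ug; apply: fpsP => n; have [N fN] := uf n; have [M gM] := ug n.
by rewrite -(fN (maxn N M)) ?leq_maxl // gM // leq_maxr.
Qed.

Lemma fps_cvg_lim u f : fps_cvg u f -> fps_lim u = f.
Proof. by move=> uf; apply: xget_unique => // g ug; apply: fps_cvg_unique ug uf. Qed.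

(* [fps_has_sum P F f]: for each n only finitely many i satisfying P have     *)
(* coef (F i) n != 0, and f is the sum of the F i over all i satisfying P.    *)
Definition fps_has_sum (I : eqType) (P : pred I) (F : I -> fps R) f :=
  forall n, exists s0 : seq I, forall s : seq I,
    uniq s -> {subset s0 <= s} -> coef (\sum_(i <- s | P i) F i) n = coef f n.

Lemma fps_has_sum_unique (I : eqType) (P : pred I) (F : I -> fps R) f g :
  fps_has_sum P F f -> fps_has_sum P F g -> f = g.
Proof.
move=> Ff Fg; apply: fpsP => n; have [s fs] := Ff n; have [t gt] := Fg n.
rewrite -(fs (undup (s ++ t))) ?undup_uniq => [||i si]; rewrite ?gt ?undup_uniq //.
- by move=> i ti; rewrite mem_undup mem_cat ti orbT.
- by rewrite mem_undup mem_cat si.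
Qed.

Lemma fps_has_sum_finite (I : eqType) (P : pred I) (F : I -> fps R) f :
  fps_has_sum P F f ->
  forall n, exists s : seq I, forall i, P i -> i \notin s -> coef (F i) n = 0.
Proof.
move=> Ff n; have [s fs] := Ff n; exists (undup s) => i Pi si.
have := fs (i :: undup s); rewrite /= si undup_uniq big_cons Pi coef_fpsD.
rewrite fs ?undup_uniq // => [/(_ isT) sum_i | j]; last by rewrite mem_undup.
apply: (addIr (coef f n)); rewrite add0r; apply: sum_i => j sj.
by rewrite inE mem_undup sj orbT.
Qed.

End Limits.

Section Pochhammer.
Variable R : comNzRingType.
Implicit Types a p : fps R.

(* (a; p)_L and (a; p)_oo                                                     *)
Definition qpoch a p (L : nat) : fps R := \prod_(i < L) (1 - a * p ^+ i).
Definition qpoch_inf a p : fps R := fps_lim (qpoch a p).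

Lemma qpoch_cvg a p : coef p 0 = 0 -> fps_cvg (qpoch a p) (qpoch_inf a p).
Proof.
move=> p0; suff uf: fps_cvg (qpoch a p) (Fps (fun n => coef (qpoch a p n.+1) n)).
  by rewrite /qpoch_inf (fps_cvg_lim uf).
move=> n; exists n.+1; elim=> // k IHk; rewrite leq_eqVlt => /predU1P[<- //|nk].
rewrite -IHk // /qpoch big_ord_recr /= mulrBr mulr1 mulrA coef_fpsB.
rewrite coef_fpsM [X in _ - X]big1 ?subr0 // => i _.
rewrite (coef_fpsX_small p0) ?mulr0 //.
by rewrite (leq_ltn_trans (leq_subr _ _)) // -ltnS.
Qed.

Lemma coef0_fpsM (f g : fps R) : coef (f * g) 0 = coef f 0 * coef g 0.
Proof. by rewrite coef_fpsM big_ord1. Qed.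

Lemma coef0_qpoch a p L : coef a 0 = 0 -> coef (qpoch a p L) 0 = 1.
Proof.
move=> a0; rewrite /qpoch; elim/big_rec: _ => [|i f _ f0].
  by rewrite coef_fps1.
by rewrite coef0_fpsM f0 mulr1 coef_fpsB coef0_fpsM a0 mul0r subr0 coef_fps1.
Qed.

Lemma coef0_qpoch_inf a p :
  coef a 0 = 0 -> coef p 0 = 0 -> coef (qpoch_inf a p) 0 = 1.
Proof.
move=> a0 p0; have [N /(_ N (leqnn N)) <-] := qpoch_cvg a p0 0.
exact: coef0_qpoch.
Qed.

(* theta (q^i; q^m) = (q^i; q^m)_oo (q^m / q^i; q^m)_oo. The quotient q^m/q^i *)
(* is written q^(m - i) since q is not invertible in R[[q]]; the definition   *)
(* is meaningful only for i <= m, as m - i is truncated otherwise.            *)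
Definition qtheta (i m : nat) : fps R :=
  qpoch_inf (fpsX ^+ i) (fpsX ^+ m) * qpoch_inf (fpsX ^+ (m - i)) (fpsX ^+ m).

Definition qthetas (s : seq nat) (m : nat) : fps R := \prod_(i <- s) qtheta i m.

Lemma coef0_qtheta i m : (0 < i < m)%N -> coef (qtheta i m) 0 = 1.
Proof.
have X0 k : (0 < k)%N -> coef (fpsX ^+ k : fps R) 0 = 0.
  by rewrite coef_fpsXn; case: k.
case/andP=> i0 im; have m0 := ltn_trans i0 im.
by rewrite coef0_fpsM !coef0_qpoch_inf ?mulr1 ?X0 ?subn_gt0.
Qed.

End Pochhammer.

(* r^2 - r s + s^2, reordered so that the truncated subtraction is exact.     *)
Definition A2form (r s : nat) : nat := (r ^ 2 + s ^ 2 - r * s)%N.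

Lemma A2formE (r s : nat) :
  (A2form r s)%:Z = r%:Z ^+ 2 - r%:Z * s%:Z + s%:Z ^+ 2.
Proof.
rewrite /A2form -subzn; first by rewrite PoszD !PoszM addrAC.
by rewrite (leq_trans _ (nat_Cauchy r s).1) // leq_pmull.
Qed.

(* Main.v *)
Require Import Defs.
From HB Require Import structures.
From mathcomp Require Import all_boot all_order all_algebra.
From mathcomp Require Import boolp classical_sets.
From mathcomp Require Import ring zify.
Set Implicit Arguments.
Unset Strict Implicit.
Unset Printing Implicit Defensive.
Import Order.TTheory GRing.Theory Num.Theory.
Local Open Scope ring_scope.

(* The A2 Bailey chain. For k1 + k2 + k3 = 0 put
     K_{r,s}(k) = (q)_{r+s} / prod_i (q)_{r-k_i} (q)_{s+k_i}.
   The q-Vandermonde sum shows that K(k) is an eigenvector, with eigenvalue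
   q^((k1^2+k2^2+k3^2)/2), of the operator
     b |-> sum_{r,s} q^(r^2-rs+s^2) b_{r,s} / ((q)_{L-r} (q)_{M-s}).
   After the shift r -> r+1, s -> s+1 the innermost factor of the multisum is
   1 / ((q)_{r-1} (q)_{s-1} (q)_{r+s-1}), which expands as sum_k alpha_k K_{r,s}(k),
   where alpha is supported on the k with pairwise distinct residues mod 3. This
   expansion is a finite form of the A2 Macdonald identity; it follows from the two
   q-Pascal rules, because the sum is antisymmetric in its three factors and
   quasi-periodic in k. Applying the operator three times and letting L = M tend to
   infinity gives a theta series of modulus 3*3+4 = 13 over (q)_oo^3. That series is
   the product (p)_oo^2 theta(q, q, q^2; p) with p = q^13: expand the three theta
   functions by the Jacobi triple product and sum one of the three indices by the
   pentagonal number theorem. The finite identities are proved in the fraction field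
   of Z[[q]], where negative powers of q are available. *)

(** * Finitely supported sums *)

Section FiniteSums.
Variable V : zmodType.

(** A relation carrying a finite support, so that sums over [int * int] can be reindexed and
    exchanged without fixing summation bounds. *)
Definition has_fsum (I : eqType) (f : I -> V) (x : V) :=
  exists2 s : seq I, uniq s & (forall i, i \notin s -> f i = 0) /\
                              \sum_(i <- s) f i = x.

Lemma sum_supp (I : eqType) (f : I -> V) (s t : seq I) :
  uniq s -> uniq t -> (forall i, i \notin s -> f i = 0) ->
  {subset s <= t} -> \sum_(i <- t) f i = \sum_(i <- s) f i.
Proof.
move=> us ut fs st; rewrite (bigID (mem s)) /= [X in _ + X]big1 ?addr0; last first.
  by move=> i; apply: fs.
rewrite -big_filter; apply: perm_big; apply: uniq_perm; rewrite ?filter_uniq //.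
move=> i; rewrite mem_filter /=; apply/andP/idP => [[]//|si]; split=> //.
exact: st.
Qed.

(** Passes to the form used by [fps_has_sum]. Conversely, adding one index outside [s0] leaves the
    sum unchanged, so [f] vanishes there. *)
Lemma has_fsum_sub (I : eqType) (f : I -> V) x :
  has_fsum f x <-> exists s0 : seq I, forall s : seq I,
    uniq s -> {subset s0 <= s} -> \sum_(i <- s) f i = x.
Proof.
split=> [[s us [fs <-]]|[s0 fs]].
  by exists s => t ut st; apply: sum_supp.
exists (undup s0); rewrite ?undup_uniq //; split; last first.
  by apply: fs; rewrite ?undup_uniq // => i; rewrite mem_undup.
move=> i; rewrite mem_undup => si.
have sum0 : \sum_(j <- undup s0) f j = x.
  by apply: fs; rewrite ?undup_uniq // => j; rewrite mem_undup.
have := fs (i :: undup s0); rewrite /= mem_undup si undup_uniq big_cons sum0.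
move=> /(_ isT) H; apply: (addIr x); rewrite add0r; apply: H => j sj.
by rewrite inE mem_undup sj orbT.
Qed.

Lemma has_fsum_unique (I : eqType) (f : I -> V) x y :
  has_fsum f x -> has_fsum f y -> x = y.
Proof.
move=> /has_fsum_sub[s fs] /has_fsum_sub[t ft].
rewrite -(fs (undup (s ++ t))) ?undup_uniq ?ft ?undup_uniq //.
  by move=> i si; rewrite mem_undup mem_cat si orbT.
by move=> i si; rewrite mem_undup mem_cat si.
Qed.

Lemma has_fsum_seq (I : eqType) (f : I -> V) (s : seq I) :
  (forall i, i \notin s -> f i = 0) -> has_fsum f (\sum_(i <- undup s) f i).
Proof.
move=> fs; exists (undup s); rewrite ?undup_uniq //; split=> // i.
by rewrite mem_undup; apply: fs.
Qed.

Lemma eq_has_fsum (I : eqType) (f g : I -> V) x :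
  f =1 g -> has_fsum f x -> has_fsum g x.
Proof. by move=> /funext ->. Qed.

Lemma has_fsum0 (I : eqType) (f : I -> V) : f =1 (fun=> 0) -> has_fsum f 0.
Proof. by move=> f0; exists [::] => //; split => //; rewrite big_nil. Qed.

Lemma has_fsum1 (I : eqType) (f : I -> V) i0 :
  (forall i, i != i0 -> f i = 0) -> has_fsum f (f i0).
Proof.
move=> f0; exists [:: i0] => //; split; last by rewrite big_seq1.
by move=> i; rewrite inE; apply: f0.
Qed.

Lemma has_fsumD (I : eqType) (f g : I -> V) x y :
  has_fsum f x -> has_fsum g y -> has_fsum (fun i => f i + g i) (x + y).
Proof.
move=> /has_fsum_sub[s fs] /has_fsum_sub[t gt]; apply/has_fsum_sub.
exists (s ++ t) => u uu stu; rewrite big_split /=; congr (_ + _).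
  by apply: fs => // i si; apply: stu; rewrite mem_cat si.
by apply: gt => // i si; apply: stu; rewrite mem_cat si orbT.
Qed.

Lemma has_fsum_sum (I : eqType) (J : Type) (r : seq J) (P : pred J)
    (f : J -> I -> V) (x : J -> V) :
  (forall j, P j -> has_fsum (f j) (x j)) ->
  has_fsum (fun i => \sum_(j <- r | P j) f j i) (\sum_(j <- r | P j) x j).
Proof.
move=> fx; elim: r => [|j r IHr].
  by rewrite big_nil; apply: has_fsum0 => i; rewrite big_nil.
rewrite big_cons; case: ifP => Pj; last first.
  by apply: eq_has_fsum IHr => i; rewrite big_cons Pj.
apply: eq_has_fsum (has_fsumD (fx j Pj) IHr) => i.
by rewrite big_cons Pj.
Qed.

Lemma has_fsum_reindex (I J : eqType) (h : J -> I) (h' : I -> J) (f : I -> V) x :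
  cancel h h' -> cancel h' h -> has_fsum f x -> has_fsum (fun j => f (h j)) x.
Proof.
move=> hK h'K [s us [fs <-]]; exists (map h' s).
  by rewrite map_inj_uniq //; apply: can_inj h'K.
split=> [j js|]; last by rewrite big_map; apply: eq_bigr => i _; rewrite h'K.
by apply: fs; apply: contra js => hs; apply/mapP; exists (h j).
Qed.

Lemma has_fsum_fiber (I J : eqType) (f : I * J -> V) (g : I -> V) x :
  has_fsum f x -> (forall i, has_fsum (fun j => f (i, j)) (g i)) -> has_fsum g x.
Proof.
move=> [s us [fs <-]] fg; exists (undup (map fst s)); rewrite ?undup_uniq //.
have f0 i j : i \notin map fst s -> f (i, j) = 0.
  move=> si; apply: fs; apply: contra si => sij.
  by apply/mapP; exists (i, j).
split=> [i|].
  rewrite mem_undup => si; apply: has_fsum_unique (fg i) _.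
  by apply: has_fsum0 => j; apply: f0.
set sI := undup _; set sJ := undup (map snd s).
(* Both sums are compared with the sum over the rectangle spanned by the projections of [s]. *)
transitivity (\sum_(p <- [seq (i, j) | i <- sI, j <- sJ]) f p).
  rewrite big_allpairs_dep; apply: eq_bigr => i _.
  apply: has_fsum_unique (fg i) _; exists sJ; rewrite ?undup_uniq //.
  split=> // j; rewrite mem_undup => sj; apply: fs; apply: contra sj => sij.
  by apply/mapP; exists (i, j).
apply: sum_supp => //; first by rewrite allpairs_uniq ?undup_uniq // => -[? ?] [].
case=> i j sij; apply/allpairsP; exists (i, j).
by rewrite !mem_undup; split=> //; apply/mapP; exists (i, j).
Qed.

(** Converse of [has_fsum_fiber]. The finite support [t] has to be given: the fibre sums may cancel
    for all but finitely many [i] without it. *)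
Lemma has_fsum_pair (I J : eqType) (f : I * J -> V) (g : I -> V) x (t : seq (I * J)) :
  (forall p, p \notin t -> f p = 0) ->
  (forall i, has_fsum (fun j => f (i, j)) (g i)) -> has_fsum g x -> has_fsum f x.
Proof.
move=> ft fg gx; have fs := has_fsum_seq ft.
by rewrite (has_fsum_unique gx (has_fsum_fiber fs fg)).
Qed.

End FiniteSums.

(** Brings identities proved in the fraction field back to power series. *)
Lemma has_fsum_inj (V W : zmodType) (h : {additive V -> W}) (I : eqType)
    (f : I -> V) x :
  injective h -> has_fsum (fun i => h (f i)) (h x) -> has_fsum f x.
Proof.
move=> hI [s us [fs hx]]; exists s => //; split=> [i /fs|].
  by rewrite -[RHS](raddf0 h) => /hI.
by apply: hI; rewrite raddf_sum.
Qed.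

Lemma has_fsumZ (R : pzRingType) (I : eqType) (f : I -> R) x a :
  has_fsum f x -> has_fsum (fun i => a * f i) (a * x).
Proof.
case=> s us [fs <-]; exists s => //; rewrite mulr_sumr; split=> // i si.
by rewrite fs ?mulr0.
Qed.

Lemma has_fsumM (R : pzRingType) (I J : eqType) (f : I -> R) (g : J -> R) x y :
  has_fsum f x -> has_fsum g y -> has_fsum (fun p => f p.1 * g p.2) (x * y).
Proof.
move=> fx gy; have [s us [fs sx]] := fx; have [t ut [gt ty]] := gy.
apply: (@has_fsum_pair _ _ _ _ (fun i => f i * y) _ [seq (i, j) | i <- s, j <- t]).
- case=> i j /= nst; have [si|/fs->] := boolP (i \in s); last by rewrite mul0r.
  have [tj|/gt->] := boolP (j \in t); last by rewrite mulr0.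
  by case/negP: nst; apply/allpairsP; exists (i, j).
- by move=> i /=; exact: (has_fsumZ (f i) gy).
- by exists s => //; rewrite -mulr_suml sx; split=> // i /fs->; rewrite mul0r.
Qed.

Definition zbox (B : nat) : seq int := [seq i%:Z - B%:Z | i <- iota 0 (B + B).+1].

Lemma mem_zbox B (x : int) : (x \in zbox B) = (`|x| <= B)%N.
Proof.
apply/mapP/idP => [[i]|xB]; first by rewrite mem_iota => ? ->; lia.
by exists `|(x + B%:Z)%R|%N; [rewrite mem_iota; lia | lia].
Qed.

Lemma has_fsum_pred (V : zmodType) (f : int -> V) (x : V) :
  has_fsum f x -> has_fsum (fun i => f (i + 1)) x.
Proof.
apply: (@has_fsum_reindex _ _ _ (fun i => i + 1) (fun i => i - 1)) => i.
  by rewrite addrK.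
by rewrite subrK.
Qed.

Lemma has_fsum_zbox (V : zmodType) (f : int -> V) (lo hi : int) :
  (forall x, f x != 0 -> lo <= x <= hi) -> exists y, has_fsum f y.
Proof.
move=> f0; exists (\sum_(x <- undup (zbox (`|lo| + `|hi|))) f x).
apply: has_fsum_seq => i; apply: contraNeq => /f0; rewrite mem_zbox; lia.
Qed.

(** * The A2 Bailey lemma *)

Section Kernel.
Variables (R : comUnitRingType) (q : R).

Definition qfact (n : nat) : R := \prod_(i < n) (1 - q ^+ i.+1).

(** The convention 1/(q)_z = 0 for z < 0 lets the sums below range over all integers. *)
Definition qfactV (z : int) : R := if z is Posz n then (qfact n)^-1 else 0.

(* Equals (q)_z for z >= 0 only; for z < 0 it is always multiplied by 0. *)
Definition qfactz (z : int) : R := qfact `|z|.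

Definition bailey_kernel (k1 k2 r s : int) : R :=
  let k3 := - k1 - k2 in
  qfactz (r + s) * (qfactV (r - k1) * qfactV (s + k1))
  * (qfactV (r - k2) * qfactV (s + k2)) * (qfactV (r - k3) * qfactV (s + k3)).

(** The linear terms come from the shift of r and s by one, which turns r^2-rs+s^2 into
    r^2-rs+s^2+r+s+1; the constant 1 is moved into the eigenvalue. *)
Definition bailey_step (b : nat -> nat -> R) (L M : nat) : R :=
  \sum_(r < L.+1) \sum_(s < M.+1)
     q ^+ (A2form r s + r + s) / (qfact (L - r) * qfact (M - s)) * b r s.

Definition bailey_seed (r s : nat) : R := (qfact r * qfact s * qfact (r + s).+1)^-1.

End Kernel.

(** Equals (k1^2+k2^2+k3^2)/2 for k3 = -k1-k2. *)
Definition Qform (k1 k2 : int) : int := k1 ^+ 2 + k1 * k2 + k2 ^+ 2.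

Section Character.
Variable R : pzRingType.

(** The nontrivial character mod 3. If k1+k2+k3 = 0 then k3-k2 = k2-k1 mod 3, so chi3(k2-k1) is
    nonzero exactly when the k_i are distinct mod 3, and then it records their cyclic order. *)
Definition chi3 (z : int) : R :=
  if (z %% 3)%Z == 1 then 1 else if (z %% 3)%Z == 2 then -1 else 0.

Lemma chi3N (z : int) : chi3 (- z) = - chi3 z.
Proof.
rewrite /chi3; have [zE|[zE|zE]] : (z %% 3)%Z = 0 \/ (z %% 3)%Z = 1 \/ (z %% 3)%Z = 2 by lia.
- have -> : ((- z) %% 3)%Z = 0 by lia.
  by rewrite zE /= oppr0.
- have -> : ((- z) %% 3)%Z = 2 by lia.
  by rewrite zE.
- have -> : ((- z) %% 3)%Z = 1 by lia.
  by rewrite zE /= opprK.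
Qed.

Lemma chi3D3 (z x : int) : chi3 (z + 3 * x) = chi3 z.
Proof. by rewrite /chi3 (_ : ((z + 3 * x) %% 3)%Z = (z %% 3)%Z) //; lia. Qed.

End Character.

Definition tri (x : int) : int := ((x * (x - 1)) %/ 2)%Z.

Lemma triE x : 2 * tri x = x * (x - 1).
Proof.
rewrite /tri mulrC divzK //.
have [y [->|->]] : exists y : int, x = 2 * y \/ x = 2 * y + 1.
  by exists (x %/ 2)%Z; lia.
- by rewrite -mulrA dvdz_mulr.
- by rewrite addrK mulrCA dvdz_mulr.
Qed.

Lemma triD x y : tri (x + y) = tri x + tri y + x * y.
Proof.
apply: (mulfI (isT : (2 : int) != 0)); rewrite !mulrDr !triE; ring.
Qed.

Lemma triN x : tri (- x) = tri x + x.
Proof.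
apply: (mulfI (isT : (2 : int) != 0)); rewrite !mulrDr !triE; ring.
Qed.

Lemma triD1 x : tri (x + 1) = tri x + x.
Proof. by rewrite triD mulr1 -[tri 1]/(0 : int) addr0. Qed.

Lemma tri_ge x : 0 <= tri x /\ - x <= tri x.
Proof. by have := triE x; split; nia. Qed.

Section QField.
Variables (K : fieldType) (q : K).
Hypotheses (q_neq0 : q != 0) (q_nroot : forall n, (0 < n)%N -> q ^+ n != 1).
Implicit Types (a b x y z L M : int).

Local Notation qf := (qfact q).
Local Notation iq := (qfactV q).
Local Notation qfz := (qfactz q).
Local Notation kernel := (bailey_kernel q).

Lemma qfS n : qf n.+1 = qf n * (1 - q ^+ n.+1).
Proof. by rewrite /qfact big_ord_recr. Qed.

Lemma subq_neq0 n : (0 < n)%N -> 1 - q ^+ n != 0.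
Proof. by move=> n0; rewrite subr_eq0 eq_sym q_nroot. Qed.

Lemma qf_neq0 n : qf n != 0.
Proof. by apply/prodf_neq0 => i _; apply: subq_neq0. Qed.

Lemma qD x y : q ^ (x + y) = q ^ x * q ^ y. Proof. exact: expfzDr. Qed.

Lemma iq_neg z : z < 0 -> iq z = 0. Proof. by case: z. Qed.

Lemma iq_ge0 z : iq z != 0 -> 0 <= z.
Proof. by case: z => // n; rewrite eqxx. Qed.

Lemma iq_pred z : iq (z - 1) = (1 - q ^ z) * iq z.
Proof.
case: z => [[|n]|n]; first by rewrite expr0z subrr mul0r.
  rewrite (_ : n.+1%:Z - 1 = n%:Z); last by lia.
  by rewrite /= qfS invfM mulrCA mulfV ?mulr1 ?subq_neq0.
by rewrite !iq_neg ?mulr0 //; lia.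
Qed.

Lemma qf_iq (n : nat) : qf n * iq n = 1.
Proof. exact: mulfV (qf_neq0 n). Qed.

(* One step of the WZ method in the upper limit L, for a weight phi equal to
   1 (D = 0) or to 1/(q)_(M-x) (D = q^M). *)
Lemma qvandermonde_step (phi : int -> K) (D : K) a b L (S : K) :
  (forall x, phi (x + 1) = (1 - D * q ^ (- x)) * phi x) ->
  a < L -> b < L ->
  has_fsum (fun x => q ^ ((x - a) * (x - b)) * iq (x - a) * iq (x - b)
                     * iq (L - 1 - x) * phi x) S ->
  has_fsum (fun x => q ^ ((x - a) * (x - b)) * iq (x - a) * iq (x - b)
                     * iq (L - x) * phi x)
    ((1 - D * q ^ (L - a - b)) * S / ((1 - q ^ (L - a)) * (1 - q ^ (L - b)))).
Proof.
move=> phiD aL bL sumS.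
(* The WZ certificate: (1-q^(L-a))(1-q^(L-b)) times the new summand is (1-D q^(L-a-b)) times the old
   one plus g(x) - g(x+1), and the difference telescopes to 0. *)
pose g x := q ^ (L - x) * (q ^ ((x - a) * (x - b)) * iq (x - 1 - a)
             * iq (x - 1 - b) * iq (L - x) * phi x).
have [|y sumg] := @has_fsum_zbox _ g a L.
  move=> x; rewrite /g !mulf_eq0 !negb_or -!andbA.
  by move=> /and5P[_ _ /iq_ge0 ? _ /andP[/iq_ge0 ? _]]; lia.
have nz z : 0 < z -> 1 - q ^ z != 0.
  by case: z => [[|n]|n] // _; apply: subq_neq0.
have := has_fsumZ ((1 - q ^ (L - a)) * (1 - q ^ (L - b)))^-1
  (has_fsumD (has_fsumZ (1 - D * q ^ (L - a - b)) sumS)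
     (has_fsumD sumg (has_fsumZ (-1) (has_fsum_pred sumg)))).
rewrite mulN1r subrr addr0 [_^-1 * _]mulrC; apply: eq_has_fsum => x.
apply: (canLR (mulKf _)); first by rewrite mulf_neq0 ?nz ?subr_gt0.
have e1 : x + 1 - 1 = x by ring.
have e2 : x - 1 - a = x - a - 1 by ring.
have e3 : x - 1 - b = x - b - 1 by ring.
have e4 : L - (x + 1) = L - x - 1 by ring.
have e5 : L - 1 - x = L - x - 1 by ring.
have e6 : q ^ ((x + 1 - a) * (x + 1 - b))
          = q ^ ((x - a) * (x - b)) * q ^ (x - a) * q ^ (x - b) * q.
  by rewrite -[X in _ = _ * X](expr1z q) -!qD; congr (_ ^ _); ring.
have e7 : q ^ (L - a - b) = q ^ (L - x) * q ^ (x - a) * q ^ (x - b) * q ^ (- x).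
  by rewrite -!qD; congr (_ ^ _); ring.
have e8 : q ^ (L - a) = q ^ (L - x) * q ^ (x - a).
  by rewrite -!qD; congr (_ ^ _); ring.
have e9 : q ^ (L - b) = q ^ (L - x) * q ^ (x - b).
  by rewrite -!qD; congr (_ ^ _); ring.
rewrite /g phiD e1 e2 e3 e4 e5 !iq_pred e6 e7 e8 e9 (qD _ (- 1)) exprN1.
move: (iq _) (iq _) (iq _) (phi x) (q ^ ((x - a) * _)) => i1 i2 i3 ph E.
move: (q ^ (L - x)) (q ^ (x - a)) (q ^ (x - b)) (q ^ (- x)) => C A B X.
by field.
Qed.

(** Induction on L from L = a, where the support a <= x <= L leaves the single term x = a. *)
Lemma qvandermonde_ind (phi : int -> K) (D : K) a b (S : int -> K) :
  (forall x, phi (x + 1) = (1 - D * q ^ (- x)) * phi x) -> b <= a ->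
  S a = iq (a - b) * phi a ->
  (forall L, a < L -> S L = (1 - D * q ^ (L - a - b)) * S (L - 1)
                            / ((1 - q ^ (L - a)) * (1 - q ^ (L - b)))) ->
  forall L, a <= L ->
  has_fsum (fun x => q ^ ((x - a) * (x - b)) * iq (x - a) * iq (x - b)
                     * iq (L - x) * phi x) (S L).
Proof.
move=> phiD ba Sa SL L aL; have [n ->] : exists n : nat, L = a + n%:Z.
  by exists `|(L - a)%R|%N; lia.
elim: n => [|n IHn] {aL}.
  rewrite addr0 Sa.
  set t := fun x => _; have <- : t a = iq (a - b) * phi a.
    by rewrite /t !subrr mul0r /= /qfact big_ord0 invr1 !mulr1 !mul1r.
  apply: has_fsum1 => x; apply: contraNeq; rewrite /t !mulf_eq0 !negb_or -!andbA.
  by move=> /and5P[_ /iq_ge0 ? _ /iq_ge0 ? _]; apply/eqP; lia.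
have an : a + n.+1%:Z - 1 = a + n%:Z by lia.
rewrite SL; last by lia.
rewrite an; apply: qvandermonde_step => //; try lia.
by rewrite an.
Qed.

Lemma iq_succ z : 0 < z -> iq z = iq (z - 1) / (1 - q ^ z).
Proof.
case: z => [[|n]|n] // _; rewrite iq_pred mulrC mulKf //.
exact: subq_neq0.
Qed.

Lemma qvandermonde1 a b L :
  has_fsum (fun x => q ^ ((x - a) * (x - b)) * iq (x - a) * iq (x - b)
                     * iq (L - x)) (iq (L - a) * iq (L - b)).
Proof.
wlog ba : a b / b <= a.
  move=> th; have [/th//|/ltW/th] := leP b a.
  rewrite [iq (L - b) * _]mulrC; apply: eq_has_fsum => x.
  by rewrite [(x - b) * _]mulrC [q ^ _ * _ * _]mulrAC.
have [aL|La] := leP a L; last first.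
  rewrite [iq (L - a)]iq_neg ?mul0r; last by lia.
  apply: has_fsum0 => x; apply/eqP; apply: contraT; rewrite !mulf_eq0 !negb_or -!andbA.
  by move=> /and4P[_ /iq_ge0 ? _ /iq_ge0 ?]; lia.
have := @qvandermonde_ind (fun=> 1) 0 a b (fun L => iq (L - a) * iq (L - b)) _ ba _ _ L aL.
move=> th; apply: eq_has_fsum (th _ _ _) => [x|x||l al].
- by rewrite mulr1.
- by rewrite mul0r subr0 mulr1.
- by rewrite subrr /= /qfact big_ord0 invr1 mulr1 mul1r.
rewrite mul0r subr0 mul1r iq_succ ?subr_gt0 // [iq (l - b)]iq_succ; last by lia.
by rewrite mulf_div !(addrAC l (-1)).
Qed.

(** By symmetry b <= a. Both sides vanish unless a <= L and a <= M; then the recurrence in L applies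
    with D = q^M. *)
Lemma qvandermonde2 a b L M :
  has_fsum (fun x => q ^ ((x - a) * (x - b)) * iq (x - a) * iq (x - b)
                     * iq (L - x) * iq (M - x))
    (qfz (L + M - a - b) * iq (L - a) * iq (L - b) * iq (M - a) * iq (M - b)).
Proof.
wlog ba : a b / b <= a.
  move=> th; have [/th//|/ltW ab] := leP b a.
  rewrite (_ : _ * _ = qfz (L + M - b - a) * iq (L - b) * iq (L - a) * iq (M - b)
                       * iq (M - a)); last by rewrite (addrAC _ (- b)); ring.
  by apply: eq_has_fsum (th b a ab) => x; rewrite [(x - a) * _]mulrC; ring.
have [/andP[aL aM]|LM] := boolP ((a <= L) && (a <= M)); last first.
  have [La|Ma] : L < a \/ M < a by lia.
    rewrite [iq (L - a)]iq_neg ?mulr0 ?mul0r; last by lia.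
    apply: has_fsum0 => x; apply/eqP; apply: contraT; rewrite !mulf_eq0 !negb_or -!andbA.
    by move=> /and5P[_ /iq_ge0 ? _ /iq_ge0 ? _]; lia.
  rewrite [iq (M - a)]iq_neg ?mulr0 ?mul0r; last by lia.
  apply: has_fsum0 => x; apply/eqP; apply: contraT; rewrite !mulf_eq0 !negb_or -!andbA.
  by move=> /and5P[_ /iq_ge0 ? _ _ /iq_ge0 ?]; lia.
have := @qvandermonde_ind (fun x => iq (M - x)) (q ^ M) a b
  (fun L => qfz (L + M - a - b) * iq (L - a) * iq (L - b) * iq (M - a) * iq (M - b))
  _ ba _ _ L aL.
apply=> [x||l al].
- by rewrite -qD -iq_pred; congr iq; ring.
- rewrite subrr (_ : a + M - a - b = M - b); last by ring.
  have -> : qfz (M - b) = (iq (M - b))^-1.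
    rewrite /qfactz; case: (M - b) (subr_ge0 b M) => [n|n] H; first by rewrite /= invrK.
    by have := ltac:(lia) : False.
  rewrite /= /qfact big_ord0 invr1 mulr1 [_ * iq (a - b)]mulrC -!mulrA; congr (_ * _).
  rewrite mulrCA mulVf ?mulr1 //; case: (M - b) (subr_ge0 b M) => [n|n] H.
    by rewrite invr_eq0 qf_neq0.
  by have := ltac:(lia) : False.
have -> : qfz (l + M - a - b) = (1 - q ^ (l + M - a - b)) * qfz (l - 1 + M - a - b).
  have -> : l + M - a - b = `|(l - 1 + M - a - b)%R|.+1%:Z by lia.
  by rewrite /qfactz absz_nat qfS mulrC.
rewrite -qD (iq_succ (z := l - a)) ?subr_gt0 // (iq_succ (z := l - b)); last by lia.
rewrite !(addrAC l (-1)) (_ : M + (l - a - b) = l + M - a - b); last by ring.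
rewrite !(addrAC l (- a) (-1)) !(addrAC l (- b) (-1)) invfM; ring.
Qed.

Let kernel_term (k1 k2 r s n : int) : K :=
  let k3 := - k1 - k2 in
  q ^ ((r - n) * (s - k3 - n)) * iq (n - k1) * iq (n - k2)
  * (iq (r - n) * iq (r - k3)) * (iq (s - k3 - n) * iq (s + k3)).

(* Reflecting the summation variable of the q-Vandermonde sum decouples r and s
   apart from the power of q. *)
Let kernel_expand k1 k2 r s :
  has_fsum (kernel_term k1 k2 r s) (kernel k1 k2 r s).
Proof.
pose k3 := - k1 - k2.
have oppZK : cancel (-%R : int -> int) -%R by move=> x; rewrite opprK.
have := has_fsum_reindex oppZK oppZK (qvandermonde2 (- r) (k3 - s) (- k1) (- k2)).
move=> /(has_fsumZ (iq (r - k3) * iq (s + k3))).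
rewrite [X in has_fsum _ X](_ : _ = kernel k1 k2 r s); last first.
  rewrite /bailey_kernel -/k3.
  have -> : - k1 - k2 - - r - (k3 - s) = r + s by rewrite /k3; ring.
  have -> : - k1 - - r = r - k1 by ring.
  have -> : - k2 - - r = r - k2 by ring.
  have -> : - k1 - (k3 - s) = s + k2 by rewrite /k3; ring.
  have -> : - k2 - (k3 - s) = s + k1 by rewrite /k3; ring.
  by ring.
apply: eq_has_fsum => n; rewrite /kernel_term -/k3.
have -> : - n - - r = r - n by ring.
have -> : - n - (k3 - s) = s - k3 - n by ring.
have -> : - k1 - - n = n - k1 by ring.
have -> : - k2 - - n = n - k2 by ring.
by ring.
Qed.

(** After [kernel_expand] the power of q has exponent (n^2+n k3+k3^2) + (r-n)(r-k3) +
    (s-k3-n)(s+k3), without a product rs. The sums over r and s are therefore separate instances of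
    [qvandermonde1], and the remaining sum over n is [qvandermonde2], which rebuilds the kernel at
    (L, M). *)
Lemma kernel_invariant k1 k2 L M :
  has_fsum (fun rs => q ^ (rs.1 ^+ 2 - rs.1 * rs.2 + rs.2 ^+ 2)
                      * (iq (L - rs.1) * iq (M - rs.2)) * kernel k1 k2 rs.1 rs.2)
           (q ^ Qform k1 k2 * kernel k1 k2 L M).
Proof.
pose k3 := - k1 - k2.
pose w (rs : int * int) := q ^ (rs.1 ^+ 2 - rs.1 * rs.2 + rs.2 ^+ 2)
                      * (iq (L - rs.1) * iq (M - rs.2)).
pose f (p : int * (int * int)) := w p.2 * kernel_term k1 k2 p.2.1 p.2.2 p.1.
suff sumf : has_fsum f (q ^ Qform k1 k2 * kernel k1 k2 L M).
  pose swap (p : (int * int) * int) := (p.2, p.1).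
  have := @has_fsum_reindex _ _ _ swap (fun p => (p.2, p.1)) f _ _ _ sumf.
  move=> /(_ (fun=> _) (fun=> _)) H; apply: has_fsum_fiber (H _ _) _.
  - by case.
  - by case.
  by case=> r s; exact: (has_fsumZ (w (r, s)) (kernel_expand k1 k2 r s)).
pose B := (`|L| + `|M| + `|k1| + `|k2| + `|k3|)%N.
apply: (@has_fsum_pair _ _ _ _ (fun n =>
    q ^ (n ^+ 2 + n * k3 + k3 ^+ 2) * iq (n - k1) * iq (n - k2)
    * ((iq (L - n) * iq (L - k3)) * (iq (M - k3 - n) * iq (M + k3)))) _
  [seq (n, rs) | n <- zbox B, rs <- [seq (r, s) | r <- zbox B, s <- zbox B]]).
- case=> n [r s]; apply: contraNeq; rewrite /f /w /kernel_term -/k3.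
  rewrite !mulf_eq0 !negb_or -!andbA.
  case/and5P => _ /iq_ge0 h1 /iq_ge0 h2 _.
  case/and5P=> /iq_ge0 h3 _ /iq_ge0 h4 /iq_ge0 h5 /andP[_ /iq_ge0 h6].
  rewrite /= in h1 h2 h3 h4 h5 h6.
  apply/allpairsP; exists (n, (r, s)); split=> //; first by rewrite mem_zbox /= /B; lia.
  by apply/allpairsP; exists (r, s); split=> //; rewrite mem_zbox /= /B; lia.
- move=> n; have := has_fsumM (qvandermonde1 n k3 L) (qvandermonde1 (k3 + n) (- k3) M).
  move=> /(has_fsumZ (q ^ (n ^+ 2 + n * k3 + k3 ^+ 2) * iq (n - k1) * iq (n - k2))).
  rewrite opprK (_ : M - (k3 + n) = M - k3 - n); last by ring.
  apply: eq_has_fsum => -[r s]; rewrite /f /w /kernel_term -/k3 /=.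
  rewrite (_ : s - (k3 + n) = s - k3 - n); last by ring.
  transitivity (q ^ (n ^+ 2 + n * k3 + k3 ^+ 2) * q ^ ((r - n) * (r - k3))
     * q ^ ((s - k3 - n) * (s + k3)) * (iq (n - k1) * iq (n - k2) *
      (iq (r - n) * iq (r - k3) * iq (L - r) *
      (iq (s - k3 - n) * iq (s + k3) * iq (M - s))))).
    ring.
  transitivity (q ^ (r ^+ 2 - r * s + s ^+ 2) * q ^ ((r - n) * (s - k3 - n)) *
     (iq (n - k1) * iq (n - k2) *
      (iq (r - n) * iq (r - k3) * iq (L - r) *
      (iq (s - k3 - n) * iq (s + k3) * iq (M - s))))); last by ring.
  congr (_ * _); rewrite -!qD; congr (q ^ _); ring.
have := has_fsumZ (q ^ Qform k1 k2 * (iq (L - k3) * iq (M + k3)))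
                  (qvandermonde2 k1 k2 L (M - k3)).
rewrite [X in has_fsum _ X](_ : _ = q ^ Qform k1 k2 * kernel k1 k2 L M); last first.
  rewrite /bailey_kernel -/k3.
  have -> : L + (M - k3) - k1 - k2 = L + M by rewrite /k3; ring.
  have -> : M - k3 - k1 = M + k2 by rewrite /k3; ring.
  have -> : M - k3 - k2 = M + k1 by rewrite /k3; ring.
  by ring.
apply: eq_has_fsum => n.
transitivity (q ^ Qform k1 k2 * q ^ ((n - k1) * (n - k2)) *
   (iq (n - k1) * iq (n - k2) * (iq (L - n) * iq (L - k3) *
   (iq (M - k3 - n) * iq (M + k3))))); first by ring.
rewrite -qD (_ : _ + _ = n ^+ 2 + n * k3 + k3 ^+ 2); first by ring.
by rewrite /Qform /k3; ring.
Qed.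

Lemma kernel_support (k1 k2 : int) r s :
  kernel k1 k2 r s != 0 ->
  [/\ k1 <= r, k2 <= r & - k1 - k2 <= r] /\ [/\ - k1 <= s, - k2 <= s & k1 + k2 <= s].
Proof.
rewrite /bailey_kernel !mulf_eq0 !negb_or -!andbA.
case/and5P=> _ /iq_ge0 ? /iq_ge0 ? /iq_ge0 ?.
by case/and3P=> /iq_ge0 ? /iq_ge0 ? /iq_ge0 ?; split; split; lia.
Qed.

(** For nonzero k some k_i is >= 1 and some is <= -1, so the kernel is supported on r, s >= 1 and
    the shift loses no term. *)
Lemma kernel_invariantS (k1 k2 : int) (L M : nat) :
  (k1, k2) != (0, 0) ->
  bailey_step q (fun r s : nat => kernel k1 k2 r.+1 s.+1) L M
  = q ^ (Qform k1 k2 - 1) * kernel k1 k2 L.+1 M.+1.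
Proof.
move=> k_neq0; have := kernel_invariant k1 k2 L.+1 M.+1.
set f := fun rs => _; move=> sumf.
apply: (mulfI (expfz_neq0 1 q_neq0)); rewrite mulrA -qD (addrCA 1) subrr addr0.
apply: has_fsum_unique sumf.
pose h (p : 'I_L.+1 * 'I_M.+1) : int * int := (p.1.+1%:Z, p.2.+1%:Z).
have h_inj : injective h.
  by case=> r s [r' s'] [] /= rr ss; congr (_, _); apply: val_inj => /=.
exists (map h (index_enum _)); rewrite ?map_inj_uniq ?index_enum_uniq //.
split=> [[r s]|].
  apply: contraNeq; rewrite /f /= mulf_eq0 negb_or mulf_eq0 negb_or mulf_eq0 negb_or.
  rewrite -!andbA => /and4P[_ /iq_ge0 rL /iq_ge0 sM /kernel_support[[? ? ?] [? ? ?]]].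
  have [r1 s1] : 1 <= r /\ 1 <= s.
    by move: k_neq0; rewrite xpair_eqE; split; lia.
  have rb : (`|(r - 1)%R| < L.+1)%N by lia.
  have sb : (`|(s - 1)%R| < M.+1)%N by lia.
  apply/mapP; exists (Ordinal rb, Ordinal sb); rewrite ?mem_index_enum //.
  by congr (_, _) => /=; lia.
rewrite big_map /bailey_step pair_big /= mulr_sumr; apply: eq_bigr => -[r s] _ /=.
rewrite mulrA; congr (_ * _); rewrite /f /=.
have -> : L.+1%:Z - r.+1%:Z = (L - r)%N by rewrite subzSS subzn // -ltnS.
have -> : M.+1%:Z - s.+1%:Z = (M - s)%N by rewrite subzSS subzn // -ltnS.
rewrite /= -invfM mulrA; congr (_ / _); rewrite (exprnP q) -qD; congr (q ^ _).
by rewrite !PoszD A2formE; lia.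
Qed.

Lemma bailey_step_sum (a : int * int -> K) (b : nat -> nat -> K) :
  a (0, 0) = 0 ->
  (forall r s : nat, has_fsum (fun k : int * int => a k * kernel k.1 k.2 r.+1 s.+1) (b r s)) ->
  forall L M : nat,
    has_fsum (fun k : int * int => a k * q ^ (Qform k.1 k.2 - 1) * kernel k.1 k.2 L.+1 M.+1)
             (bailey_step q b L M).
Proof.
move=> a0 sumb L M.
have H := has_fsum_sum (index_enum 'I_L.+1) (P := xpredT) (fun r _ =>
   has_fsum_sum (index_enum 'I_M.+1) (P := xpredT) (fun s _ =>
     has_fsumZ (q ^+ (A2form r s + r + s) / (qf (L - r) * qf (M - s))) (sumb r s))).
apply: eq_has_fsum H => k.
have [->|k0] := eqVneq k (0, 0).
  rewrite a0 !mul0r big1 // => r _; rewrite big1 // => s _.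
  by rewrite mul0r mulr0.
rewrite -mulrA -kernel_invariantS -?surjective_pairing // mulr_sumr.
apply: eq_bigr => r _; rewrite mulr_sumr; apply: eq_bigr => s _.
by rewrite mulrCA.
Qed.

(** The finite Jacobi triple product, by induction on n. The new factor is (1+q^(2n+1)) + y q^n +
    y^-1 q^(n+1); its last two terms shift a by one, and the coefficients of each y^a then agree. *)
Lemma finite_triple_product (y : K) (n : nat) : y != 0 ->
  has_fsum (fun a : int => y ^ a * q ^ tri a * (qf n.*2 * (iq (n%:Z - a) * iq (n%:Z + a))))
           (\prod_(j < n) ((1 + y * q ^+ j) * (1 + y^-1 * q ^+ j.+1))).
Proof.
move=> y_neq0; elim: n => [|n IHn].
  set f := fun a => _; rewrite big_ord0.
  have <- : f 0 = 1.
    by rewrite /f (_ : tri 0 = 0) // !expr0z subr0 /= /qfact !big_ord0 !(invr1, mulr1).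
  apply: has_fsum1 => a; apply: contraNeq; rewrite /f !mulf_eq0 !negb_or -!andbA.
  by case/and5P=> _ _ _ /iq_ge0 ? /iq_ge0 ?; apply/eqP; lia.
rewrite big_ord_recr /=; set P := \prod_(_ < n) _ in IHn *.
pose f (a : int) := y ^ a * q ^ tri a * (qf n.*2 * (iq (n%:Z - a) * iq (n%:Z + a))).
have subK : cancel (fun a : int => a - 1) (fun a => a + 1) by move=> a; rewrite subrK.
have addK : cancel (fun a : int => a + 1) (fun a => a - 1) by move=> a; rewrite addrK.
have := has_fsumD (has_fsumZ (1 + q ^+ n.*2.+1) IHn)
  (has_fsumD (has_fsumZ (y * q ^+ n) (has_fsum_reindex subK addK IHn))
             (has_fsumZ (y^-1 * q ^+ n.+1) (has_fsum_pred IHn))).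
rewrite (_ : P * _ = (1 + q ^+ n.*2.+1) * P + (y * q ^+ n * P + y^-1 * q ^+ n.+1 * P)); last first.
  by rewrite -addnn (exprS q (n + n)) (exprS q n) exprD; field.
apply: eq_has_fsum => a.
have -> : n%:Z - a = n.+1%:Z - a - 1 by lia.
have -> : n%:Z + a = n.+1%:Z + a - 1 by lia.
have -> : n%:Z - (a - 1) = n.+1%:Z - a by lia.
have -> : n%:Z + (a - 1) = n.+1%:Z + a - 1 - 1 by lia.
have -> : n%:Z - (a + 1) = n.+1%:Z - a - 1 - 1 by lia.
have -> : n%:Z + (a + 1) = n.+1%:Z + a by lia.
have e : tri a = tri (a - 1) + (a - 1) by rewrite -triD1 subrK.
rewrite triD1 e !iq_pred doubleS !qfS.
have -> : q ^ (tri (a - 1) + (a - 1) + a) = q ^ tri (a - 1) * q ^ a * q ^ a / q.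
  by rewrite -exprN1 -!qD; congr (q ^ _); ring.
have -> : q ^ (tri (a - 1) + (a - 1)) = q ^ tri (a - 1) * q ^ a / q.
  by rewrite -exprN1 -!qD; congr (q ^ _); ring.
have -> : y ^ (a - 1) = y ^ a / y by rewrite expfzDr // exprN1.
have -> : y ^ (a + 1) = y ^ a * y by rewrite expfzDr // expr1z.
have -> : q ^ (n.+1%:Z - a) = q ^+ n.+1 / q ^ a by rewrite qD -invr_expz.
have -> : q ^ (n.+1%:Z + a) = q ^+ n.+1 * q ^ a by rewrite qD.
have -> : q ^ (n.+1%:Z - a - 1) = q ^+ n / q ^ a.
  by rewrite exprnP invr_expz -!qD; congr (q ^ _); lia.
have -> : q ^ (n.+1%:Z + a - 1) = q ^+ n * q ^ a.
  by rewrite exprnP -!qD; congr (q ^ _); lia.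
have -> : q ^+ n.*2.+2 = q ^+ n.+1 * q ^+ n.+1 by rewrite -exprD; congr (_ ^+ _); lia.
have -> : q ^+ n.*2.+1 = q ^+ n * q ^+ n.+1 by rewrite -exprD; congr (_ ^+ _); lia.
rewrite !(exprS q n).
have := expfz_neq0 a q_neq0; move: (iq _) (iq _) (q ^ tri _) (y ^ a) (q ^ a) => i j t ya qa qa0.
by field; rewrite qa0 y_neq0 q_neq0.
Qed.

Local Notation chi3 := (chi3 K).

(** * The expansion of the seed *)

(* With k3 = -k1-k2 the exponent is 2(k1^2+k2^2+k3^2-2)/3, the division being exact
   whenever the character does not vanish. *)
Definition weight (k1 k2 : int) : K :=
  chi3 (k2 - k1) * q ^ (4 * ((Qform k1 k2 - 1) %/ 3)%Z).

Lemma weight_swap k1 k2 : weight k2 k1 = - weight k1 k2.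
Proof.
by rewrite /weight -opprB chi3N mulNr (_ : Qform k2 k1 = Qform k1 k2) // /Qform; ring.
Qed.

Lemma weight_cyc k1 k2 : weight (- k1 - k2) k1 = weight k1 k2.
Proof.
rewrite /weight (_ : Qform (- k1 - k2) k1 = Qform k1 k2); last by rewrite /Qform; ring.
by rewrite -(chi3D3 _ (k2 - k1) k1); congr (chi3 _ * _); ring.
Qed.

(** The translation adds 3(k1+k2+1) to [Qform], so the integer quotient by 3 changes exactly,
    whatever the residue. *)
Lemma weight_wrap k1 k2 :
  weight (k1 + 1) (k2 + 1) = q ^ (4 * (k1 + k2 + 1)) * weight k1 k2.
Proof.
rewrite /weight mulrCA -qD (_ : k2 + 1 - (k1 + 1) = k2 - k1); last by ring.
rewrite (_ : Qform (k1 + 1) (k2 + 1) - 1 = (k1 + k2 + 1) * 3 + (Qform k1 k2 - 1)); last first.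
  by rewrite /Qform; ring.
by rewrite divzMDl // mulrDr.
Qed.

(* The coefficient function k |-> q^(-ck) [n; r-k] is encoded by (n, r, c). *)
Definition gauss (t : nat * int * int) (k : int) : K :=
  let: (n, r, c) := t in q ^ (- c * k) * (qf n * iq (r - k) * iq (n%:Z - r + k)).

Arguments gauss : simpl never.

Lemma gauss_fin t : exists B : nat, forall k : int, k \notin zbox B -> gauss t k = 0.
Proof.
case: t => -[n r] c; exists (`|r| + n)%N => k; apply: contraNeq.
rewrite /gauss !mulf_eq0 !negb_or -!andbA.
case/and4P=> _ _ /iq_ge0 rk /iq_ge0 nk; rewrite mem_zbox; lia.
Qed.

(** In both q-Pascal rules the factor q^k or q^(-k) is absorbed by a change of c, which leaves
    coefficients free of k that can be pulled out of the sums. *)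
Lemma gauss_pascal1 n r c k :
  gauss (n.+1, r, c) k
  = gauss (n, r, c) k + q ^ (n.+1%:Z - r) * gauss (n, r - 1, c - 1) k.
Proof.
rewrite /gauss qfS.
have -> : n%:Z - r + k = (n.+1%:Z - r + k) - 1 by lia.
have -> : n%:Z - (r - 1) + k = n.+1%:Z - r + k by lia.
have -> : r - 1 - k = r - k - 1 by ring.
have -> : - (c - 1) * k = - c * k + k by ring.
have -> : q ^+ n.+1 = q ^ (n.+1%:Z - r) * q ^ k * q ^ (r - k).
  by rewrite -!qD exprnP; congr (q ^ _); ring.
by rewrite !iq_pred !qD; ring.
Qed.

Lemma gauss_pascal2 n r c k :
  gauss (n.+1, r, c) k
  = q ^ r * gauss (n, r, c + 1) k + gauss (n, r - 1, c) k.
Proof.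
rewrite /gauss qfS.
have -> : n%:Z - r + k = (n.+1%:Z - r + k) - 1 by lia.
have -> : n%:Z - (r - 1) + k = n.+1%:Z - r + k by lia.
have -> : r - 1 - k = r - k - 1 by ring.
have -> : - (c + 1) * k = - c * k - k by ring.
have -> : q ^+ n.+1 = q ^ (n.+1%:Z - r + k) * q ^ (r - k).
  by rewrite -!qD exprnP; congr (q ^ _); ring.
have -> : q ^ r = q ^ k * q ^ (r - k) by rewrite -qD; congr (q ^ _); ring.
rewrite !iq_pred (qD (- c * k)) -invr_expz; field.
exact: expfz_neq0.
Qed.

Implicit Types (t : nat * int * int).

Definition alt_term t1 t2 t3 (k : int * int) : K :=
  weight k.1 k.2 * (gauss t1 k.1 * gauss t2 k.2 * gauss t3 (- k.1 - k.2)).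

(** Defined by choice, so that linear relations can be written as equations; by [alt_sumP] the sum
    always exists. *)
Definition alt_sum t1 t2 t3 : K :=
  xget 0 [set x | has_fsum (alt_term t1 t2 t3) x]%classic.

Lemma alt_sumP t1 t2 t3 : has_fsum (alt_term t1 t2 t3) (alt_sum t1 t2 t3).
Proof.
apply: (@xgetPex _ 0 [set x | has_fsum (alt_term t1 t2 t3) x]%classic).
have [B1 h1] := gauss_fin t1; have [B2 h2] := gauss_fin t2.
set s := [seq (i, j) | i <- zbox B1, j <- zbox B2].
suff fin k : k \notin s -> alt_term t1 t2 t3 k = 0.
  by exists (\sum_(k <- undup s) alt_term t1 t2 t3 k); exact: has_fsum_seq fin.
case: k => i j nst; rewrite /alt_term /=; have [iB|/h1->] := boolP (i \in zbox B1); last first.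
  by rewrite !mul0r mulr0.
have [jB|/h2->] := boolP (j \in zbox B2); last by rewrite mulr0 mul0r mulr0.
by case/negP: nst; apply/allpairsP; exists (i, j).
Qed.

Lemma alt_sumE t1 t2 t3 (x : K) : has_fsum (alt_term t1 t2 t3) x -> alt_sum t1 t2 t3 = x.
Proof. exact: has_fsum_unique (alt_sumP _ _ _). Qed.

Lemma alt_sum_cyc t1 t2 t3 : alt_sum t1 t2 t3 = alt_sum t2 t3 t1.
Proof.
apply: alt_sumE; pose h (k : int * int) := (k.2, - k.1 - k.2).
pose h' (k : int * int) := (- k.1 - k.2, k.1).
have hK : cancel h h' by case=> i j; rewrite /h /h' /=; congr (_, _); ring.
have h'K : cancel h' h by case=> i j; rewrite /h /h' /=; congr (_, _); ring.
apply: eq_has_fsum (has_fsum_reindex hK h'K (alt_sumP t2 t3 t1)) => -[i j].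
rewrite /alt_term /h /= -(weight_cyc i j) -(weight_cyc (- i - j) i).
rewrite (_ : - j - (- i - j) = i); last by ring.
rewrite (_ : - (- i - j) - i = j); last by ring.
by congr (_ * _); ring.
Qed.

(** Together with [alt_sum_cyc] this gives antisymmetry under all permutations of the factors. *)
Lemma alt_sum_swap t1 t2 t3 : alt_sum t2 t1 t3 = - alt_sum t1 t2 t3.
Proof.
apply: alt_sumE; pose h (k : int * int) := (k.2, k.1).
have hK : cancel h h by case.
have := has_fsumZ (-1) (has_fsum_reindex hK hK (alt_sumP t1 t2 t3)).
rewrite mulN1r; apply: eq_has_fsum => -[i j]; rewrite /alt_term /h /= weight_swap.
by rewrite [- j - i]addrC; ring.
Qed.

Lemma alt_sum_pascal1 n r c t2 t3 :
  alt_sum (n.+1, r, c) t2 t3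
  = alt_sum (n, r, c) t2 t3 + q ^ (n.+1%:Z - r) * alt_sum (n, r - 1, c - 1) t2 t3.
Proof.
apply: alt_sumE; apply: eq_has_fsum (has_fsumD (alt_sumP _ _ _)
  (has_fsumZ (q ^ (n.+1%:Z - r)) (alt_sumP (n, r - 1, c - 1) t2 t3))) => k.
by rewrite /alt_term gauss_pascal1; ring.
Qed.

Lemma alt_sum_pascal2 n r c t2 t3 :
  alt_sum (n.+1, r, c) t2 t3
  = q ^ r * alt_sum (n, r, c + 1) t2 t3 + alt_sum (n, r - 1, c) t2 t3.
Proof.
apply: alt_sumE; apply: eq_has_fsum (has_fsumD
  (has_fsumZ (q ^ r) (alt_sumP (n, r, c + 1) t2 t3)) (alt_sumP (n, r - 1, c) t2 t3)) => k.
by rewrite /alt_term gauss_pascal2; ring.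
Qed.

Lemma gauss_shift n r c k d : gauss (n, r, c) (k + d) = q ^ (- c * d) * gauss (n, r - d, c) k.
Proof.
rewrite /gauss mulrA -qD -mulrDr [d + k]addrC.
by congr (_ * (_ * iq _ * iq _)); ring.
Qed.

Lemma gauss_twist n r c k d : gauss (n, r, c + d) k = q ^ (- d * k) * gauss (n, r, c) k.
Proof. by rewrite /gauss mulrA -qD; congr (q ^ _ * _); ring. Qed.

(** A common twist contributes q^(-d(k1+k2+k3)) = 1. *)
Lemma alt_sum_twist d n1 r1 c1 n2 r2 c2 n3 r3 c3 :
  alt_sum (n1, r1, c1 + d) (n2, r2, c2 + d) (n3, r3, c3 + d)
  = alt_sum (n1, r1, c1) (n2, r2, c2) (n3, r3, c3).
Proof.
apply: alt_sumE; apply: eq_has_fsum (alt_sumP _ _ _) => k.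
rewrite /alt_term !gauss_twist; set x := gauss _ _; set y := gauss _ _; set z := gauss _ _.
have e : q ^ (- d * k.1) * q ^ (- d * k.2) * q ^ (- d * (- k.1 - k.2)) = 1.
  by rewrite -!qD -(expr0z q); congr (q ^ _); ring.
by rewrite -[LHS]mulr1 -e; ring.
Qed.

(* Translating k by (1, 1, -2) preserves the residues mod 3 of the k_i - k_j. *)
Lemma alt_sum_wrap n1 r1 c1 n2 r2 c2 n3 r3 c3 :
  alt_sum (n1, r1, c1) (n2, r2, c2) (n3, r3, c3)
  = q ^ (4 - c1 - c2 + 2 * c3)
    * alt_sum (n1, r1 - 1, c1) (n2, r2 - 1, c2) (n3, r3 + 2, c3 + 4).
Proof.
pose h (k : int * int) := (k.1 + 1, k.2 + 1).
pose h' (k : int * int) := (k.1 - 1, k.2 - 1).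
have hK : cancel h h' by case=> i j; rewrite /h /h' /= !addrK.
have h'K : cancel h' h by case=> i j; rewrite /h /h' /= !subrK.
apply: has_fsum_unique
  (has_fsum_reindex hK h'K (alt_sumP (n1, r1, c1) (n2, r2, c2) (n3, r3, c3))) _.
apply: eq_has_fsum (has_fsumZ _ (alt_sumP _ _ _)) => -[i j].
rewrite /alt_term /h /= weight_wrap (_ : - (i + 1) - (j + 1) = - i - j + - 2); last by ring.
rewrite (gauss_shift _ _ _ i) (gauss_shift _ _ _ j) (gauss_shift _ _ _ (- i - j)).
rewrite gauss_twist opprK.
set x := gauss _ _; set y := gauss _ _; set z := gauss _ _.
transitivity (weight i j * x * y * z * (q ^ (4 - c1 - c2 + 2 * c3) * q ^ (- 4 * (- i - j)))).
  by ring.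
transitivity (weight i j * x * y * z * (q ^ (4 * (i + j + 1)) * q ^ (- c1 * 1)
  * q ^ (- c2 * 1) * q ^ (- c3 * - 2))); last by ring.
by rewrite -!qD; congr (_ * q ^ _); ring.
Qed.

Hypothesis two_neq0 : 2%:R != 0 :> K.

Lemma alt_sum0 t t3 : alt_sum t t t3 = 0.
Proof.
have /eqP := alt_sum_swap t t t3.
by rewrite -subr_eq0 opprK -mulr2n -mulr_natl mulf_eq0 (negPf two_neq0) => /eqP.
Qed.

(** Expand the first factor by the second Pascal rule and the second factor by the first. Of the
    four terms two have a repeated factor and vanish; the other two differ by a swap. *)
Lemma alt_sum_pair n r c t3 :
  alt_sum (n.+1, r, c) (n.+1, r, c + 1) t3
  = (1 - q ^+ n.+1) * alt_sum (n, r - 1, c) (n, r, c + 1) t3.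
Proof.
have step t1 : alt_sum t1 (n.+1, r, c + 1) t3 = alt_sum t1 (n, r, c + 1) t3
    + q ^ (n.+1%:Z - r) * alt_sum t1 (n, r - 1, c) t3.
  by rewrite alt_sum_cyc alt_sum_pascal1 -!(alt_sum_cyc t1) addrK.
rewrite alt_sum_pascal2 !step !alt_sum0 mulr0 addr0 add0r.
rewrite (alt_sum_swap (n, r - 1, c)) exprnP.
have -> : q ^ n.+1 = q ^ r * q ^ (n.+1%:Z - r) by rewrite -qD; congr (q ^ _); ring.
by ring.
Qed.

(** The staggered sum to which [alt_sum_flat] reduces; by [packedE] it is q^(-2) times a single
    q-binomial coefficient. *)
Definition packed n (r : int) := alt_sum (n, r - 1, 1) (n, r, 2) (n, r + 1, 3).

(* The q-Pascal rules applied to the first and to the third factor give two linear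
   equations in the same two sums, which the quasi-periodicity identifies. *)
Lemma packed_rec n (r : int) :
  (1 - q ^ (n.+1%:Z - r)) * packed n.+1 r = (1 - q ^+ n.+1) * packed n r.
Proof.
pose U := alt_sum (n, r - 1, 1) (n.+1, r, 2) (n.+1, r + 1, 3).
pose V := alt_sum (n.+1, r - 1, 1) (n.+1, r, 2) (n, r, 3).
(* Lowering the second and then the third factor produces extra terms with a repeated factor. *)
have U_packed : U = packed n r.
  rewrite /U alt_sum_cyc alt_sum_pascal1 (_ : 2 - 1 = 1 :> int) //.
  rewrite [X in _ + _ * X]alt_sum_cyc [X in _ + _ * X]alt_sum_cyc alt_sum0 mulr0 addr0.
  rewrite alt_sum_cyc alt_sum_pascal1 (_ : 3 - 1 = 2 :> int) // addrK.
  rewrite [X in _ + _ * X]alt_sum_cyc [X in _ + _ * X]alt_sum_swap.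
  rewrite [X in _ + _ * - X]alt_sum_cyc [X in _ + _ * - X]alt_sum_cyc.
  by rewrite alt_sum0 oppr0 mulr0 addr0 alt_sum_cyc.
have eq1 : packed n.+1 r = U + q ^ (n.+1%:Z - r) * V.
  rewrite /packed alt_sum_pascal1 subrr; congr (_ + _).
  (* A wrap followed by a common twist by -1 turns the second Pascal term into V; [eq2] treats U in
     the same way. *)
  rewrite [X in _ * X]alt_sum_cyc alt_sum_wrap mulrA -qD.
  rewrite (_ : r + 1 - 1 = r); last by ring.
  rewrite (_ : r - 1 - 1 + 2 = r); last by ring.
  rewrite -(alt_sum_twist (-1)); congr (q ^ _ * _); first by ring.
have eq2 : packed n.+1 r = q ^ r * U + V.
  rewrite /packed alt_sum_cyc alt_sum_cyc alt_sum_pascal2 addrK.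
  rewrite [X in _ * X + _]alt_sum_cyc [X in _ + X]alt_sum_cyc; congr (_ + _).
  rewrite /U [in RHS]alt_sum_cyc [in RHS]alt_sum_wrap mulrA -qD.
  rewrite (_ : r + 1 - 1 = r); last by ring.
  rewrite (_ : r - 1 + 2 = r + 1); last by ring.
  rewrite -[in RHS](alt_sum_twist (-1)); congr (q ^ _ * _); by ring.
rewrite -U_packed [LHS]mulrBl mul1r {1}eq1 eq2 exprnP.
have -> : q ^ n.+1 = q ^ (n.+1%:Z - r) * q ^ r by rewrite -qD; congr (q ^ _); ring.
by ring.
Qed.

(** Induction on n - r by [packed_rec]. At n = r the supports give k1 >= -1, k2 >= 0, k3 >= 1, so
    only k = (-1, 0, 1) contributes. *)
Lemma packedE (n r : nat) :
  (r <= n)%N -> packed n r = q ^ (- 2) * (qf n * iq r * iq (n - r)%N).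
Proof.
move=> /subnK <-; elim: (n - r)%N => {n} [|m IHm]; last first.
  have := packed_rec (m + r) r; rewrite IHm addSn (_ : (m + r).+1%:Z - r%:Z = m.+1); last by lia.
  rewrite (_ : ((m + r).+1 - r = m.+1)%N); last by lia.
  rewrite (_ : ((m + r) - r = m)%N); last by lia.
  rewrite qfS /= qfS [(_ * (1 - q ^+ m.+1))^-1]invfM => H.
  apply: (mulfI (subq_neq0 (ltn0Sn m))); rewrite H.
  have := subq_neq0 (ltn0Sn m); move: (1 - q ^+ m.+1) (q ^ (- 2)) => x y x_neq0.
  by field; rewrite x_neq0 !qf_neq0.
rewrite add0n subnn /packed; apply: alt_sumE.
have -> : q ^ (- 2) * (qf r * iq r * iq 0%N)
    = alt_term (r, r%:Z - 1, 1) (r, r%:Z, 2) (r, r%:Z + 1, 3) (-1, 0).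
  rewrite /alt_term /weight /= (_ : Qform (-1) 0 - 1 = 0) // div0z mulr0 expr0z.
  rewrite /chi3 /= mulr1 mul1r /gauss.
  have -> : r%:Z - 1 - -1 = r by ring.
  have -> : r%:Z - (r%:Z - 1) + -1 = 0 by ring.
  have -> : r%:Z - r%:Z + 0 = 0 by ring.
  have -> : r%:Z - 0 = r by ring.
  have -> : r%:Z + 1 - (- -1 - 0) = r by ring.
  have -> : r%:Z - (r%:Z + 1) + (- -1 - 0) = 0 by ring.
  have iq0 : iq 0 = 1 by rewrite /= /qfact big_ord0 invr1.
  by rewrite iq0 qf_iq !mulr1 -!qD /qfact big_ord0 divr1 mulr1.
apply: has_fsum1 => -[i j]; apply: contraNeq; rewrite /alt_term /gauss /=.
rewrite !mulf_eq0 !negb_or -!andbA.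
case/and5P=> _ _ _ _ /and5P[/iq_ge0 h1 /iq_ge0 h2 _ _ /and5P[/iq_ge0 h3 /iq_ge0 h4 _ _]].
case/andP=> /iq_ge0 h5 /iq_ge0 h6.
by apply/eqP; congr (_, _); lia.
Qed.

(** Apply [alt_sum_pair], lower the third factor, and apply [alt_sum_pair] to both resulting terms.
    After one more Pascal step each is a multiple of the same packed sum, and their difference
    supplies the second factor 1 - q^(n+2). *)
Lemma alt_sum_flat n r :
  alt_sum (n.+2, r, 1) (n.+2, r, 2) (n.+2, r, 3)
  = (1 - q ^+ n.+2) ^+ 2 * (1 - q ^+ n.+1) * packed n (r - 1).
Proof.
have -> := alt_sum_pair n.+1 r 1 (n.+2, r, 3).
have -> : alt_sum (n.+1, r - 1, 1) (n.+1, r, 2) (n.+2, r, 3)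
  = alt_sum (n.+1, r, 2) (n.+1, r, 2 + 1) (n.+1, r - 1, 1)
    - q ^ (n.+2%:Z - r) * alt_sum (n.+1, r - 1, 1) (n.+1, r - 1, 1 + 1) (n.+1, r, 2).
  rewrite alt_sum_cyc alt_sum_cyc alt_sum_pascal1 (_ : 3 - 1 = 2 :> int) //.
  rewrite [X in X + _]alt_sum_cyc [X in X + _]alt_sum_cyc.
  by rewrite [X in _ * X]alt_sum_swap mulrN.
rewrite !alt_sum_pair -[2 + 1]/(3 : int) -[1 + 1]/(2 : int).
have step t1 t2 c : alt_sum t1 t2 (n.+1, r, c)
    = q ^ r * alt_sum t1 t2 (n, r, c + 1) + alt_sum t1 t2 (n, r - 1, c).
  by rewrite alt_sum_cyc alt_sum_cyc alt_sum_pascal2 -!(alt_sum_cyc t2) -!(alt_sum_cyc t1).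
have step' t1 t2 : alt_sum t1 t2 (n.+1, r - 1, 1)
    = q ^ (r - 1) * alt_sum t1 t2 (n, r - 1, 1 + 1) + alt_sum t1 t2 (n, r - 1 - 1, 1).
  by rewrite alt_sum_cyc alt_sum_cyc alt_sum_pascal2 -!(alt_sum_cyc t2) -!(alt_sum_cyc t1).
rewrite step step' -[1 + 1]/(2 : int) -[2 + 1]/(3 : int).
rewrite [X in q ^ (r - 1) * X]alt_sum_cyc [X in q ^ (r - 1) * X]alt_sum_cyc alt_sum0 mulr0 add0r.
rewrite [alt_sum _ (n, r - 1, 2) (n, r - 1, 2)]alt_sum_cyc alt_sum0 addr0.
rewrite /packed subrK -(alt_sum_cyc (n, r - 1 - 1, 1)) (exprnP _ n.+2).
have -> : q ^ n.+2 = q ^ (n.+2%:Z - r) * q ^ r by rewrite -qD; congr (q ^ _); ring.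
by ring.
Qed.

(** The exponent 2k1+k2 is -k1-2k2-3k3, from the twists c = 1, 2, 3; the constant 2 cancels the
    q^(-2) of [packedE]. *)
Definition seed_weight (k1 k2 : int) : K := weight k1 k2 * q ^ (2 + 2 * k1 + k2).

Lemma seed_weight0 : seed_weight 0 0 = 0.
Proof. by rewrite /seed_weight /weight /chi3 !mul0r. Qed.

(** The kernel at (r+1, s+1) is a product of three q-binomials of order r+s+2 divided by
    (q)_(r+s+2)^2, so the sum is an instance of [alt_sum_flat]. *)
Lemma seed_sum (r s : nat) :
  has_fsum (fun k => seed_weight k.1 k.2 * kernel k.1 k.2 r.+1 s.+1)
           (qf r * qf s * qf (r + s).+1)^-1.
Proof.
have := has_fsumZ (q ^+ 2 / qf (r + s).+2 ^+ 2) (alt_sumP ((r + s).+2, r.+1%:Z, 1)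
  ((r + s).+2, r.+1%:Z, 2) ((r + s).+2, r.+1%:Z, 3)).
rewrite alt_sum_flat (_ : r.+1%:Z - 1 = r); last by lia.
rewrite packedE ?leq_addr // addKn.
rewrite [X in has_fsum _ X](_ : _ = (qf r * qf s * qf (r + s).+1)^-1); last first.
  rewrite !qfS -exprnN /=; field.
  by rewrite !qf_neq0 q_neq0 !subq_neq0.
apply: eq_has_fsum => -[i j]; rewrite /alt_term /seed_weight /bailey_kernel /gauss /=.
have h k : (r + s).+2%:Z - r.+1%:Z + k = s.+1%:Z + k by lia.
rewrite !h /qfactz (_ : `|(r.+1%:Z + s.+1%:Z)%R|%N = (r + s).+2); last by lia.
set a := iq _; set b := iq _; set c := iq _; set d := iq _; set e := iq _; set f := iq _.
transitivity (weight i j * qf (r + s).+2 * (a * b * (c * d) * (e * f)) *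
  (q ^ 2 * q ^ (- 1 * i) * q ^ (- 2 * j) * q ^ (- 3 * (- i - j)))).
  by field; rewrite qf_neq0.
rewrite -!qD (_ : 2 + - 1 * i + - 2 * j + - 3 * (- i - j) = 2 + 2 * i + j); last by ring.
by rewrite -/a; ring.
Qed.

Lemma bailey_chain_sum (L M : nat) :
  has_fsum (fun k : int * int => seed_weight k.1 k.2 * q ^ (3 * (Qform k.1 k.2 - 1))
                     * kernel k.1 k.2 L.+1 M.+1)
           (iter 3 (bailey_step q) (bailey_seed q) L M).
Proof.
pose a0 (k : int * int) := seed_weight k.1 k.2.
pose a n (k : int * int) := iter n (fun x : K => x * q ^ (Qform k.1 k.2 - 1)) (a0 k).
have an n : a n (0, 0) = 0.
  by rewrite /a; elim: n => [|n /= ->]; rewrite ?mul0r //= /a0 seed_weight0.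
have sums n (L' M' : nat) : has_fsum (fun k => a n k * kernel k.1 k.2 L'.+1 M'.+1)
    (iter n (bailey_step q) (bailey_seed q) L' M').
  elim: n L' M' => [|n IHn] L' M'; first exact: seed_sum.
  exact: (bailey_step_sum (an n) IHn).
apply: eq_has_fsum (sums 3 L M) => k; rewrite /a /= /a0; move: (Qform _ _ - 1) => x.
by rewrite (_ : 3 * x = x + x + x) ?qD; ring.
Qed.


End QField.

(** * Infinite sums of power series *)

Section FpsSums.
Variable R : comNzRingType.
Implicit Types f g : fps R.

Definition has_fps_sum (I : eqType) (F : I -> fps R) f :=
  forall n, has_fsum (fun i => coef (F i) n) (coef f n).

Lemma fps_has_sumE (I : eqType) (P : pred I) (F : I -> fps R) f :
  has_fps_sum (fun i => if P i then F i else 0) f -> fps_has_sum P F f.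
Proof.
move=> Ff n; have /has_fsum_sub[s0 fs] := Ff n; exists s0 => s us ss.
by rewrite -(fs s us ss) coef_fps_sum big_mkcond; apply: eq_bigr => i _; case: ifP.
Qed.

Lemma has_fps_sum_unique (I : eqType) (F : I -> fps R) f g :
  has_fps_sum F f -> has_fps_sum F g -> f = g.
Proof. by move=> Ff Fg; apply: fpsP => n; apply: has_fsum_unique (Ff n) (Fg n). Qed.

Lemma eq_has_fps_sum (I : eqType) (F G : I -> fps R) f :
  F =1 G -> has_fps_sum F f -> has_fps_sum G f.
Proof. by move=> /funext ->. Qed.

Lemma has_fps_sum_fin (I : eqType) (F : I -> fps R) f :
  has_fsum F f -> has_fps_sum F f.
Proof.
case=> s us [fs <-] n; exists s => //; split=> [i /fs->//|].
by rewrite coef_fps_sum.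
Qed.

Lemma has_fps_sum_exists (I : eqType) (F : I -> fps R) :
  (forall n, exists s : seq I, forall i, i \notin s -> coef (F i) n = 0) ->
  exists f, has_fps_sum F f.
Proof.
move=> /choice[s fs].
by exists (Fps (fun n => \sum_(i <- undup (s n)) coef (F i) n)) => n; exact: has_fsum_seq (fs n).
Qed.

Lemma has_fps_sum_support (I : eqType) (F : I -> fps R) f : has_fps_sum F f ->
  forall n, exists s : seq I, forall i m, i \notin s -> (m <= n)%N -> coef (F i) m = 0.
Proof.
move=> Ff; elim=> [|n [s IHn]].
  by have [s _ [fs _]] := Ff 0; exists s => i m /fs Fi; rewrite leqn0 => /eqP->.
have [t _ [ft _]] := Ff n.+1; exists (s ++ t) => i m.
rewrite mem_cat negb_or => /andP[si ti]; rewrite leq_eqVlt => /predU1P[->|mn].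
  exact: ft.
exact: IHn.
Qed.

Lemma coef_fpsM_eq0 f g n : (forall m, (m <= n)%N -> coef f m = 0) -> coef (f * g) n = 0.
Proof.
by move=> f0; rewrite coef_fpsM big1 // => i _; rewrite f0 ?mul0r // -ltnS.
Qed.

Lemma coef_fpsM_eqr f g h n :
  (forall m, (m <= n)%N -> coef g m = coef h m) -> coef (f * g) n = coef (f * h) n.
Proof. by move=> gh; rewrite !coef_fpsM; apply: eq_bigr => i _; rewrite gh ?leq_subr. Qed.

Lemma coef_XnM k f n : (n < k)%N -> coef (fpsX ^+ k * f) n = 0.
Proof.
move=> nk; apply: coef_fpsM_eq0 => m mn.
by rewrite coef_fpsXn (ltn_eqF (leq_ltn_trans mn nk)).
Qed.

Lemma coef_signXnM b k f n : (n < k)%N -> coef ((-1) ^+ b * fpsX ^+ k * f) n = 0.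
Proof.
move=> nk; rewrite mulrAC mulrC; exact: coef_XnM.
Qed.

Lemma has_fps_sumZ (I : eqType) (F : I -> fps R) f g :
  has_fps_sum F f -> has_fps_sum (fun i => g * F i) (g * f).
Proof.
move=> Ff n; rewrite coef_fpsM.
apply: eq_has_fsum (has_fsum_sum _ _) => [i|j _]; first by rewrite coef_fpsM.
exact: (has_fsumZ (coef g j) (Ff (n - j)%N)).
Qed.

Lemma has_fps_sum_reindex (I J : eqType) (h : J -> I) (h' : I -> J) (F : I -> fps R) f :
  cancel h h' -> cancel h' h -> has_fps_sum F f -> has_fps_sum (fun j => F (h j)) f.
Proof. by move=> hK h'K Ff n; apply: (has_fsum_reindex hK h'K (Ff n)). Qed.

Lemma has_fps_sum_fiber (I J : eqType) (F : I * J -> fps R) (G : I -> fps R) f :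
  has_fps_sum F f -> (forall i, has_fps_sum (fun j => F (i, j)) (G i)) -> has_fps_sum G f.
Proof. by move=> Ff FG n; apply: has_fsum_fiber (Ff n) _ => i; apply: FG. Qed.

Lemma has_fps_sumM (I J : eqType) (F : I -> fps R) (G : J -> fps R) f g :
  has_fps_sum F f -> has_fps_sum G g ->
  has_fps_sum (fun p : I * J => F p.1 * G p.2) (f * g).
Proof.
move=> Ff Gg n; have [s Fs] := has_fps_sum_support Ff n.
have [t Gt] := has_fps_sum_support Gg n.
apply: (@has_fsum_pair _ _ _ _ (fun i => coef (F i * g) n) _ [seq (i, j) | i <- s, j <- t]).
- case=> i j /= nst; have [si|/Fs Fi] := boolP (i \in s); last exact: coef_fpsM_eq0.
  have [tj|/Gt Gj] := boolP (j \in t); last by rewrite mulrC; apply: coef_fpsM_eq0.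
  by case/negP: nst; apply/allpairsP; exists (i, j).
- by move=> i; apply: (has_fps_sumZ (F i) Gg).
- have := has_fps_sumZ g Ff; rewrite mulrC => /(_ n); apply: eq_has_fsum => i.
  by rewrite mulrC.
Qed.

Lemma fps_cvg_le (u : nat -> fps R) f : fps_cvg u f ->
  forall n, exists N, forall k m, (N <= k)%N -> (m <= n)%N -> coef (u k) m = coef f m.
Proof.
move=> uf; elim=> [|n [N IHn]].
  by have [N uN] := uf 0; exists N => k m /uN; rewrite leqn0 => H /eqP->.
have [M uM] := uf n.+1; exists (maxn N M) => k m; rewrite geq_max => /andP[Nk Mk].
by rewrite leq_eqVlt => /predU1P[->|mn]; [apply: uM | apply: IHn].
Qed.

(* Tannery's theorem: termwise limits can be taken under a convergent sum. *)
Lemma fps_tannery (I : eqType) (F : I -> fps R) (c : I -> nat -> fps R)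
    (y : nat -> fps R) f l :
  has_fps_sum F f -> (forall i, fps_cvg (c i) l) ->
  (forall k, has_fps_sum (fun i => F i * c i k) (y k)) -> fps_cvg y (f * l).
Proof.
move=> Ff cl Fy n; have [s Fs] := has_fps_sum_support Ff n.
have /choice[N cN] : forall i, exists N, forall k m, (N <= k)%N -> (m <= n)%N ->
    coef (c i k) m = coef l m.
  by move=> i; apply: fps_cvg_le.
(* Only the finitely many i in [s] affect the n-th coefficient. *)
exists (\max_(i <- s) N i) => k Nk; apply: has_fsum_unique (Fy k n) _.
have := has_fps_sumZ l Ff n; rewrite mulrC; apply: eq_has_fsum => i.
have [si|/Fs Fi] := boolP (i \in s); last by rewrite mulrC !coef_fpsM_eq0.
rewrite mulrC; apply: coef_fpsM_eqr => m mn; apply/esym/cN => //.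
by apply: leq_trans Nk; apply: leq_bigmax_seq.
Qed.

Lemma fps_cvgM (u v : nat -> fps R) f g :
  fps_cvg u f -> fps_cvg v g -> fps_cvg (fun k => u k * v k) (f * g).
Proof.
move=> /fps_cvg_le uf /fps_cvg_le vg n; have [N uN] := uf n; have [M vM] := vg n.
exists (maxn N M) => k; rewrite geq_max => /andP[Nk Mk]; rewrite !coef_fpsM.
by apply: eq_bigr => i _; rewrite uN ?vM ?leq_subr // -ltnS.
Qed.

Lemma fps_cvg_cst f : fps_cvg (fun=> f) f.
Proof. by move=> n; exists 0%N. Qed.

Lemma fps_cvg_sub (u : nat -> fps R) f (h : nat -> nat) :
  (forall N, exists M, forall k, (M <= k)%N -> (N <= h k)%N) ->
  fps_cvg u f -> fps_cvg (u \o h) f.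
Proof.
move=> hinf uf n; have [N uN] := uf n; have [M hM] := hinf N.
by exists M => k /hM /uN.
Qed.

Lemma fps_cvg_eventually (u v : nat -> fps R) f N :
  (forall k, (N <= k)%N -> u k = v k) -> fps_cvg u f -> fps_cvg v f.
Proof.
move=> uv uf n; have [M uM] := uf n; exists (maxn N M) => k.
by rewrite geq_max => /andP[Nk Mk]; rewrite -uv ?uM.
Qed.

Lemma fps_cvg_prod (I : Type) (r : seq I) (u : I -> nat -> fps R) (f : I -> fps R) :
  (forall i, fps_cvg (u i) (f i)) ->
  fps_cvg (fun k => \prod_(i <- r) u i k) (\prod_(i <- r) f i).
Proof.
move=> uf; elim: r => [|i r IHr].
  rewrite big_nil; apply: (fps_cvg_eventually (N := 0%N) _ (fps_cvg_cst 1)) => k _.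
  by rewrite big_nil.
rewrite big_cons; apply: (fps_cvg_eventually (N := 0%N) _ (fps_cvgM (uf i) IHr)) => k _.
by rewrite big_cons.
Qed.

End FpsSums.

Lemma fps_cvgV (R : comUnitRingType) (u : nat -> fps R) f :
  f \is a GRing.unit -> (forall k, u k \is a GRing.unit) ->
  fps_cvg u f -> fps_cvg (fun k => (u k)^-1) f^-1.
Proof.
move=> Uf Uu uf n; have [N uN] := fps_cvg_le uf n; exists N => k Nk.
have -> : (u k)^-1 = f^-1 + (f - u k) * (f^-1 / u k).
  by rewrite mulrBl (mulrA f) mulrV // mul1r (mulrCA (u k)) mulrV // mulr1 addrC subrK.
rewrite coef_fpsD coef_fpsM_eq0 ?addr0 // => m mn.
by rewrite coef_fpsB uN ?subrr.
Qed.

(** The lowest nonzero coefficients of f and g multiply to a coefficient of f g. *)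
Lemma fps_integral (R : idomainType) (f g : fps R) : f * g = 0 -> (f == 0) || (g == 0).
Proof.
have lowest (h : fps R) : h != 0 ->
    exists2 n, coef h n != 0 & forall m, (m < n)%N -> coef h m = 0.
  move=> h0; have exn : exists n, coef h n != 0.
    apply: contrapT => /forallNP h00; case/eqP: h0; apply: fpsP => n.
    by have /negP := h00 n; rewrite negbK => /eqP.
  exists (ex_minn exn); first by case: ex_minnP.
  move=> m; case: ex_minnP => n _ min mn; apply/eqP; apply: contraTT mn => /min.
  by rewrite -leqNgt.
move=> fg0; apply: contraT; rewrite negb_or => /andP[/lowest[n fn minf] /lowest[m gm ming]].
have /eqP := congr1 (fun h => coef h (n + m)) fg0.
rewrite coef_fpsM (bigD1 (inord n)) //= inordK ?ltnS ?leq_addr // addKn big1; last first.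
  move=> i ni; have [/minf->|ni'] := ltnP i n; first by rewrite mul0r.
  rewrite ming ?mulr0 //; have lt_ni : (n < i)%N.
    rewrite ltn_neqAle ni' andbT; apply: contra ni => /eqP ni.
    by apply/eqP/val_inj; rewrite /= inordK ?ltnS ?leq_addr.
  by have := ltn_ord i; lia.
by rewrite addr0 mulf_eq0 (negPf fn) (negPf gm).
Qed.

HB.instance Definition _ (R : idomainType) :=
  GRing.ComUnitRing_isIntegral.Build (fps R) (@fps_integral R).

Lemma tofrac_inj (R : idomainType) : injective (@FracField.tofrac R).
Proof. by move=> x y /eqP; rewrite tofrac_eq => /eqP. Qed.

Lemma tofracV (R : idomainType) (x : R) :
  x \is a GRing.unit -> FracField.tofrac x^-1 = (FracField.tofrac x)^-1.
Proof. exact: rmorphV. Qed.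

(** * Transfer to the fraction field, and limits of q-factorials *)

Section Transfer.
Variable R : idomainType.
Implicit Type p : fps R.
Local Notation "x %:F" := (FracField.tofrac x).

Lemma qpochE p n : qpoch p p n = qfact p n.
Proof. by apply: eq_bigr => i _; rewrite exprS. Qed.

Lemma qfact_unit p n : coef p 0 = 0 -> qfact p n \is a GRing.unit.
Proof. by move=> p0; rewrite fps_unitE -qpochE coef0_qpoch ?unitr1. Qed.

Lemma qpoch_inf_unit p : coef p 0 = 0 -> qpoch_inf p p \is a GRing.unit.
Proof. by move=> p0; rewrite fps_unitE coef0_qpoch_inf ?unitr1. Qed.

Lemma tofrac_qfact p n : (qfact p n)%:F = qfact p%:F n.
Proof.
rewrite /qfact rmorph_prod; apply: eq_bigr => i _.
by rewrite rmorphB rmorph1 rmorphXn.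
Qed.

Lemma tofrac_qfactV p z : coef p 0 = 0 -> (qfactV p z)%:F = qfactV p%:F z.
Proof.
case: z => [n|n] p0; rewrite /qfactV ?rmorph0 // -tofrac_qfact.
exact: tofracV (qfact_unit n p0).
Qed.

Lemma tofrac_kernel p k1 k2 r s : coef p 0 = 0 ->
  (bailey_kernel p k1 k2 r s)%:F = bailey_kernel p%:F k1 k2 r s.
Proof. by move=> p0; rewrite /bailey_kernel !rmorphM /= !tofrac_qfactV ?tofrac_qfact. Qed.

Lemma tofrac_bailey_step p (b : nat -> nat -> fps R) L M : coef p 0 = 0 ->
  (bailey_step p b L M)%:F = bailey_step p%:F (fun r s => (b r s)%:F) L M.
Proof.
move=> p0; rewrite /bailey_step rmorph_sum; apply: eq_bigr => r _.
rewrite rmorph_sum; apply: eq_bigr => s _.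
rewrite !rmorphM rmorphXn -!tofrac_qfact -rmorphM; congr (_ * _ * _).
by apply: tofracV; rewrite unitrM !qfact_unit.
Qed.

Lemma tofrac_bailey_chain p n L M : coef p 0 = 0 ->
  (iter n (bailey_step p) (bailey_seed p) L M)%:F
  = iter n (bailey_step p%:F) (bailey_seed p%:F) L M.
Proof.
move=> p0; elim: n L M => [|n IHn] L M /=.
  rewrite /bailey_seed -!tofrac_qfact -!rmorphM.
  by apply: tofracV; rewrite !unitrM !qfact_unit.
rewrite tofrac_bailey_step //; congr bailey_step.
by apply: funext => r; apply: funext => s.
Qed.

Lemma fps_cvg_qfactV p (h : nat -> int) : coef p 0 = 0 ->
  (forall N : nat, exists M : nat, forall k, (M <= k)%N -> N%:Z <= h k) ->
  fps_cvg (fun k => qfactV p (h k)) (qpoch_inf p p)^-1.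
Proof.
move=> p0 hinf; have cvgV := fps_cvgV (qpoch_inf_unit p0)
  (fun k => (_ : qpoch p p k \is a GRing.unit)) (qpoch_cvg p p0).
have [M hM] := hinf 0%N.
apply: (@fps_cvg_eventually _ ((fun k => (qpoch p p k)^-1) \o (fun k => `|h k|%N)) _ _ M).
  by move=> k /hM; rewrite /= /qfactV; case: (h k) => // n _; rewrite qpochE.
apply: fps_cvg_sub (cvgV _) => [N|k]; last by rewrite qpochE qfact_unit.
by have [M' hM'] := hinf N; exists M' => k /hM'; lia.
Qed.

Lemma fps_cvg_qfact p (h : nat -> nat) : coef p 0 = 0 ->
  (forall k, (k <= h k)%N) -> fps_cvg (fun k => qfact p (h k)) (qpoch_inf p p).
Proof.
move=> p0 hk; apply: (@fps_cvg_eventually _ (qpoch p p \o h) _ _ 0) => [k _|].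
  by rewrite /= qpochE.
by apply: fps_cvg_sub (qpoch_cvg p p0) => N; exists N => k /leq_trans; apply.
Qed.

End Transfer.

(** The factors 1 - p^i are sorted by the residue of i mod d. *)
Lemma qpoch_dissect (R : comNzRingType) (p : fps R) d n :
  qpoch p p (d * n) = \prod_(j < d) qpoch (p ^+ j.+1) (p ^+ d) n.
Proof.
elim: n => [|n IHn].
  by rewrite muln0 /qpoch big_ord0 big1 // => j _; rewrite big_ord0.
transitivity (qpoch p p (d * n) * \prod_(j < d) (1 - p ^+ j.+1 * (p ^+ d) ^+ n)).
  rewrite mulnS addnC /qpoch big_split_ord /=; congr (_ * _).
  by apply: eq_bigr => j _; rewrite -exprM -exprS -exprD addSn [(j + _)%N]addnC.
rewrite IHn -big_split /=; apply: eq_bigr => j _.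
by rewrite /qpoch big_ord_recr.
Qed.

Lemma qpoch_inf_dissect (R : comNzRingType) (p : fps R) d : coef p 0 = 0 -> (0 < d)%N ->
  qpoch_inf p p = \prod_(j < d) qpoch_inf (p ^+ j.+1) (p ^+ d).
Proof.
move=> p0 d0; have pd0 : coef (p ^+ d) 0 = 0.
  by case: d d0 => // d _; rewrite exprS coef0_fpsM p0 mul0r.
have H := fps_cvg_prod (index_enum 'I_d) (fun j : 'I_d => qpoch_cvg (p ^+ j.+1) pd0).
apply: fps_cvg_unique _ H.
apply: (@fps_cvg_eventually _ (qpoch p p \o muln d) _ _ 0) => [n _|].
  by rewrite /= qpoch_dissect.
apply: fps_cvg_sub (qpoch_cvg p p0) => N; exists N => k Nk.
by rewrite (leq_trans Nk) // leq_pmull.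
Qed.

(** * Theta series *)

Section Theta.
Local Notation q := (fpsX : fps int).
Local Notation "x %:F" := (FracField.tofrac x).

Lemma coef0_Xn m : (0 < m)%N -> coef (q ^+ m) 0 = 0.
Proof. by rewrite coef_fpsXn; case: m. Qed.

Lemma fracX_neq0 : q%:F != 0.
Proof.
rewrite tofrac_eq0; apply/eqP => /(congr1 (fun f => coef f 1)).
by rewrite coef_fps0.
Qed.

Lemma fracXn_neq0 m : (q ^+ m)%:F != 0.
Proof. by rewrite rmorphXn expf_neq0 // fracX_neq0. Qed.

Lemma fracXn_nroot m : (0 < m)%N -> forall n, (0 < n)%N -> (q ^+ m)%:F ^+ n != 1.
Proof.
move=> m0 n n0; rewrite -rmorphXn -exprM -(rmorph1 (FracField.tofrac (R := fps int))).
rewrite tofrac_eq; apply/eqP => /(congr1 (fun f => coef f 0)).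
by rewrite coef0_Xn ?muln_gt0 ?m0.
Qed.

(** By [jexp_ge0] the exponent is nonnegative for i <= m, so the absolute value does not alter
    it. *)
Definition jterm (m i : nat) (a : int) : fps int :=
  (-1) ^+ `|a|%N * q ^+ `|(m%:Z * tri a + i%:Z * a)%R|%N.

Lemma jexp_ge0 (m i : nat) (a : int) : (i <= m)%N -> 0 <= m%:Z * tri a + i%:Z * a.
Proof.
move=> im; have [t0 ta] := tri_ge a.
have [a0|a0] := leP 0 a; first by rewrite addr_ge0 // mulr_ge0.
have : i%:Z * - tri a <= i%:Z * a by rewrite ler_wpM2l //; lia.
have : i%:Z * tri a <= m%:Z * tri a by rewrite ler_wpM2r //; lia.
by rewrite mulrN; lia.
Qed.

Lemma jexp_ge (m i : nat) (a : int) : (0 < i < m)%N ->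
  (`|a| <= `|(m%:Z * tri a + i%:Z * a)%R|)%N.
Proof.
move=> /andP[i0 im]; have [t0 ta] := tri_ge a.
have e0 := @jexp_ge0 m i a (ltnW im).
have [a0|a0] := leP 0 a.
  have : 0 <= m%:Z * tri a by rewrite mulr_ge0.
  have : 1 * a <= i%:Z * a by rewrite ler_wpM2r //; lia.
  lia.
have : i%:Z * - tri a <= i%:Z * a by rewrite ler_wpM2l //; lia.
have : (i%:Z + 1) * tri a <= m%:Z * tri a by rewrite ler_wpM2r //; lia.
by rewrite mulrN mulrDl; lia.
Qed.

Lemma jterm_summable m i : (0 < i < m)%N -> exists f, has_fps_sum (jterm m i) f.
Proof.
move=> im; apply: has_fps_sum_exists => n; exists (zbox n) => a.
rewrite mem_zbox -ltnNge => na; rewrite /jterm -[_ * _]mulr1 coef_signXnM //.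
exact: leq_trans na (jexp_ge a im).
Qed.

(** The finite identity with base p = q^m and y = -q^i, in the limit n to infinity: (p)_(2n) /
    ((p)_(n-a) (p)_(n+a)) tends to 1/(p)_oo. *)
Lemma triple_product m i : (0 < i < m)%N ->
  has_fps_sum (jterm m i) (qpoch_inf (q ^+ m) (q ^+ m) * qtheta int i m).
Proof.
move=> im; have [f fE] := jterm_summable im.
have [i0 lt_im] := andP im; have m0 := ltn_trans i0 lt_im.
have p0 := coef0_Xn m0; set p := q ^+ m in p0 *.
pose P := qpoch_inf p p; have uP : P \is a GRing.unit by apply: qpoch_inf_unit.
pose c (a : int) (n : nat) := qfact p n.*2 * (qfactV p (n%:Z - a) * qfactV p (n%:Z + a)).
suff -> : qtheta int i m = f * P^-1 by rewrite -/P mulrC divrK.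
have cvg_theta : fps_cvg (fun n => qpoch (q ^+ i) p n * qpoch (q ^+ (m - i)) p n)
    (qtheta int i m).
  by apply: fps_cvgM; apply: qpoch_cvg.
apply: fps_cvg_unique cvg_theta _.
apply: (fps_tannery (c := c) fE) => [a|n].
  have : P^-1 = P * (P^-1 * P^-1) by rewrite mulrA mulrV // mul1r.
  move=> ->; apply: fps_cvgM; first by apply: fps_cvg_qfact => // k; lia.
  by apply: fps_cvgM; apply: fps_cvg_qfactV => // N; exists (N + `|a|)%N; lia.
apply: has_fps_sum_fin; apply: (has_fsum_inj (h := FracField.tofrac (R := fps int))).
  exact: tofrac_inj.
have y0 : - (q ^+ i)%:F != 0 by rewrite oppr_eq0 fracXn_neq0.
have := finite_triple_product (fracXn_neq0 m) (fracXn_nroot m0) n y0.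
rewrite [X in has_fsum _ X](_ : _ =
    (qpoch (q ^+ i) p n * qpoch (q ^+ (m - i)) p n)%:F); last first.
  rewrite /qpoch -big_split rmorph_prod; apply: eq_bigr => j _.
  rewrite /= tofracM !tofracB tofrac1 invrN !mulNr -!tofracXn -tofracM.
  congr (_ * (1 - _)); apply: (mulfI (fracXn_neq0 i)).
  rewrite mulrA mulfV ?fracXn_neq0 // mul1r -!tofracM /p -!exprM -!exprD.
  by congr (FracField.tofrac (_ ^+ _)); rewrite addnA subnKC ?(ltnW lt_im) // mulnS.
apply: eq_has_fsum => a; rewrite [RHS]/= /c !tofracM tofrac_qfact !tofrac_qfactV //.
congr (_ * _); rewrite !tofracXn tofracN tofrac1 -[- _]mulN1r exprzMl; last 2 first.
- by rewrite unitfE oppr_eq0 oner_eq0.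
- by rewrite unitfE expf_neq0 // fracX_neq0.
have -> : (-1 : {fraction (fps int)}) ^+ `|a|%N = (-1) ^ a.
  by case: a => // a; rewrite NegzE -exprnN abszN absz_nat; rewrite -exprVn invrN1.
rewrite -mulrA; congr (_ * _); rewrite !exprnP !exprz_exp -expfzDr ?fracX_neq0 //.
by congr (_ ^ _); rewrite gez0_abs ?jexp_ge0 ?(ltnW lt_im) // addrC.
Qed.

End Theta.

(** * The product of three theta functions as a double series *)

Section ThetaSum.
Local Notation q := (fpsX : fps int).

Definition sgn (a : int) : fps int := (-1) ^+ `|a|%N.

Lemma sgnD a b : sgn a * sgn b = sgn (a + b).
Proof.
rewrite /sgn -exprD -[LHS]signr_odd -[RHS]signr_odd; congr (_ ^+ (nat_of_bool _)); lia.
Qed.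

Lemma sgnM2 a : sgn (2 * a) = 1.
Proof. by rewrite /sgn abszM exprM expr2 mulrNN mulr1 expr1n. Qed.

Lemma sgnN a : sgn (- a) = sgn a. Proof. by rewrite /sgn abszN. Qed.

Definition xpow (e : int) : fps int := q ^+ `|e|%N.

Lemma xpowD a b : 0 <= a -> 0 <= b -> xpow a * xpow b = xpow (a + b).
Proof. by move=> a0 b0; rewrite /xpow -exprD; congr (_ ^+ _); lia. Qed.

Lemma jtermE m i a : jterm m i a = sgn a * xpow (m%:Z * tri a + i%:Z * a).
Proof. by []. Qed.

(** In the triple product of modulus 3m at i = m, the three infinite products are the residue
    classes mod 3 of (q^m; q^m)_oo. *)
Lemma pentagonal m : (0 < m)%N ->
  has_fps_sum (jterm (3 * m) m) (qpoch_inf (q ^+ m) (q ^+ m)).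
Proof.
move=> m0; have := @triple_product (3 * m) m; rewrite m0 ltn_Pmull // => /(_ isT).
rewrite (qpoch_inf_dissect (d := 3) (coef0_Xn m0)) // !big_ord_recl big_ord0 /=.
rewrite /qtheta -!exprM !(mulnC m); congr has_fps_sum.
by rewrite (_ : 3 * m - m = 2 * m)%N ?mul1n; [ring | lia].
Qed.

Definition ctriple (m : nat) (a b c : int) : fps int :=
  jterm m 1 a * jterm m 1 b * jterm m 2 c.

Lemma ctripleE m a b c : (1 < m)%N ->
  ctriple m a b c = sgn (a + b + c)
                    * xpow (m%:Z * (tri a + tri b + tri c) + a + b + 2 * c).
Proof.
move=> m1; rewrite /ctriple !jtermE.
have ea := @jexp_ge0 m 1 a (ltnW m1); have eb := @jexp_ge0 m 1 b (ltnW m1).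
have ec := @jexp_ge0 m 2 c m1.
transitivity (sgn a * sgn b * sgn c * (xpow (m%:Z * tri a + 1%N%:Z * a)
  * xpow (m%:Z * tri b + 1%N%:Z * b) * xpow (m%:Z * tri c + 2%N%:Z * c))); first by ring.
by rewrite !sgnD (xpowD ea eb) (xpowD (addr_ge0 ea eb) ec); congr (_ * xpow _); ring.
Qed.

(* In terms of (u, v), k = (u-1, v-u, 1-v). *)
Definition theta_term (m : nat) (uv : int * int) : fps int :=
  let h := ((uv.1 + uv.2) %/ 3)%Z in
  if ((uv.1 + uv.2) %% 3)%Z == 2 then 0 else ctriple m (uv.1 - h) (uv.2 - h) h.

Lemma has_fps_sum_fiber_exists (R : comNzRingType) (I J : eqType)
    (F : I * J -> fps R) f :
  has_fps_sum F f -> forall i, exists g, has_fps_sum (fun j => F (i, j)) g.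
Proof.
move=> Ff i; apply: has_fps_sum_exists => n.
have [s _ [fs _]] := Ff n; exists (map snd s) => j sj; apply: fs.
by apply: contra sj => sij; apply/mapP; exists (i, j).
Qed.

(* The fibre over (u, v) of (a, b, c) |-> (a+c, b+c) contributes a pentagonal sum, or
   0 if u + v = 2 mod 3. *)
Lemma theta_sum m : (2 < m)%N ->
  has_fps_sum (theta_term m)
    (qpoch_inf (q ^+ m) (q ^+ m) ^+ 2 * (qtheta int 1 m ^+ 2 * qtheta int 2 m)).
Proof.
move=> m2; have m1 := ltnW m2; have m0 := ltnW m1.
set P := qpoch_inf _ _; have uP : P \is a GRing.unit.
  by apply: qpoch_inf_unit; apply: coef0_Xn.
have J1 := @triple_product m 1 m1; have J2 := @triple_product m 2 m2.
have := has_fps_sumM (has_fps_sumM J1 J1) J2; rewrite -/P.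
pose h (p : (int * int) * int) := ((p.1.1 - p.2, p.1.2 - p.2), p.2).
pose h' (p : (int * int) * int) := ((p.1.1 + p.2, p.1.2 + p.2), p.2).
have hK : cancel h h' by case=> -[a b] c; rewrite /h /h' /= !subrK.
have h'K : cancel h' h by case=> -[a b] c; rewrite /h /h' /= !addrK.
move=> /(has_fps_sum_reindex hK h'K) sumF.
have Pm := pentagonal m0; rewrite -/P in Pm.
suff fib uv : has_fps_sum (fun c => ctriple m (uv.1 - c) (uv.2 - c) c) (P * theta_term m uv).
  have := has_fps_sumZ P^-1 (has_fps_sum_fiber sumF fib).
  rewrite [X in has_fps_sum _ X](_ : _ = P ^+ 2 * (qtheta int 1 m ^+ 2 * qtheta int 2 m)).
    by apply: eq_has_fps_sum => uv; rewrite mulKr.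
  by apply: (mulrI uP); rewrite (mulVKr uP); ring.
case: uv => u v; rewrite /theta_term /=.
set k := ((u + v) %/ 3)%Z; set d := ((u + v) %% 3)%Z.
have uvE : u + v = 3 * k + d by rewrite mulrC -divz_eq.
have dcase : d = 0 \/ d = 1 \/ d = 2 by rewrite /d; lia.
(* Recentring the fibre at k, the quotient of u+v by 3, leaves a factor whose exponent depends only
   on c and the residue d. *)
have shiftE c : ctriple m (u - (c + k)) (v - (c + k)) (c + k)
    = ctriple m (u - k) (v - k) k * (sgn c * xpow (m%:Z * (3 * tri c + (2 - d) * c))).
  have c0 : 0 <= m%:Z * (3 * tri c + (2 - d) * c).
    by have [t0 tc] := tri_ge c; rewrite mulr_ge0 //; case: dcase => [->|[->|->]]; lia.
  have e0 : 0 <= m%:Z * (tri (u - k) + tri (v - k) + tri k) + (u - k) + (v - k) + 2 * k.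
    have := @jexp_ge0 m 1 (u - k) (ltnW m1); have := @jexp_ge0 m 1 (v - k) (ltnW m1).
    by have := @jexp_ge0 m 2 k m1; rewrite !mulrDr; lia.
  rewrite !ctripleE // mulrACA sgnD xpowD //; congr (_ * _).
    rewrite -[RHS]mul1r -(sgnM2 (- c)) sgnD; congr sgn; ring.
  have tE x : tri (x - (c + k)) = tri (x - k) + tri c + c - (x - k) * c.
    by rewrite opprD addrCA addrC triD triN mulrN; ring.
  rewrite !tE (triD c k); congr xpow.
  have {tE}-> : v = 3 * k + d - u by rewrite -uvE; ring.
  ring.
have kK : cancel (fun c : int => c + k) (fun c => c - k) by move=> c; rewrite addrK.
have Kk : cancel (fun c : int => c - k) (fun c => c + k) by move=> c; rewrite subrK.
suff : has_fps_sum (fun c => ctriple m (u - (c + k)) (v - (c + k)) (c + k))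
    (P * (if d == 2 then 0 else ctriple m (u - k) (v - k) k)).
  move=> /(has_fps_sum_reindex Kk kK); apply: eq_has_fps_sum => c.
  by rewrite subrK.
case: dcase shiftE => [->|[->|->]] /= shiftE.
(* For d = 0 the reflection of c turns 3 tri(c) + 2c into the pentagonal exponent 3 tri(c) + c; for
   d = 1 it has that form already. *)
- have oppK : cancel (-%R : int -> int) -%R by move=> c; rewrite opprK.
  have := has_fps_sumZ (ctriple m (u - k) (v - k) k) (has_fps_sum_reindex oppK oppK Pm).
  rewrite mulrC; apply: eq_has_fps_sum => c; rewrite shiftE jtermE sgnN.
  by rewrite triN PoszM; congr (_ * (_ * xpow _)); ring.
- have := has_fps_sumZ (ctriple m (u - k) (v - k) k) Pm.
  rewrite mulrC; apply: eq_has_fps_sum => c; rewrite shiftE jtermE.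
  by rewrite PoszM; congr (_ * (_ * xpow _)); ring.
(* For d = 2 the involution c -> 1-c keeps the exponent 3 tri(c) and changes the sign, so the fibre
   sum equals its own negative. *)
have [g gE] := has_fps_sum_fiber_exists sumF (u, v).
have {}gE := has_fps_sum_reindex kK Kk gE; rewrite /= in gE.
have rK : cancel (fun c : int => 1 - c) (fun c => 1 - c).
  by move=> c; rewrite opprB addrCA subrr addr0.
have := has_fps_sumZ (-1) (has_fps_sum_reindex rK rK gE).
have -> : (fun c => -1 * (jterm m 1 (u - (1 - c + k)) * jterm m 1 (v - (1 - c + k))
                          * jterm m 2 (1 - c + k)))
   = (fun c => jterm m 1 (u - (c + k)) * jterm m 1 (v - (c + k)) * jterm m 2 (c + k)).
  apply: funext => c; have := shiftE c; have := shiftE (1 - c); rewrite /ctriple => -> ->.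
  have -> : tri (1 - c) = tri c.
    by rewrite addrC triD triN -[tri 1]/(0 : int) mulr1 addr0 addrK.
  have -> : sgn (1 - c) = - sgn c.
    by rewrite -sgnD sgnN /sgn mulN1r.
  by rewrite subrr !mul0r; ring.
move=> /(has_fps_sum_unique gE) gN; rewrite mulr0.
suff <- : g = 0 by [].
apply: fpsP => n; have /(congr1 (fun f => coef f n)) := gN.
rewrite mulN1r coef_fpsN coef_fps0 => /eqP; rewrite -subr_eq0 opprK -mulr2n.
by rewrite mulrn_eq0 => /eqP.
Qed.

End ThetaSum.

(** * The limit of the Bailey chain *)

Section ChainLimit.
Local Notation q := (fpsX : fps int).
Local Notation "x %:F" := (FracField.tofrac x).

(** Here k2-k1 = d+1 mod 3, so both sides vanish for d = 2. Otherwise [Qform] - 1 = 3t: the weight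
    contributes 4t and the three Bailey steps 9t, which gives the modulus 13. Both linear parts
    equal u+v. *)
Lemma tofrac_theta_term (u v : int) :
  (theta_term 13 (u, v))%:F
  = seed_weight q%:F (u - 1) (v - u) * q%:F ^ (3 * (Qform (u - 1) (v - u) - 1)).
Proof.
rewrite /theta_term /seed_weight /weight /=.
set h := ((u + v) %/ 3)%Z; set d := ((u + v) %% 3)%Z.
have uvE : u + v = 3 * h + d by rewrite mulrC -divz_eq.
have vE : v = 3 * h + d - u by rewrite -uvE; ring.
have -> : chi3 {fraction (fps int)} (v - u - (u - 1)) = chi3 {fraction (fps int)} (d + 1).
  by rewrite -(chi3D3 _ (d + 1) (h - u)); congr chi3; rewrite vE; ring.
have [->|d2] := eqVneq d 2; first by rewrite tofrac0 /chi3 !mul0r.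
have {d2} d01 : d = 0 \/ d = 1 by rewrite /d in d2 *; lia.
set t := tri (u - h) + tri (v - h) + tri h.
have QE : Qform (u - 1) (v - u) - 1 = 3 * t.
  apply: (mulfI (isT : (2 : int) != 0)).
  rewrite [RHS]mulrCA !mulrDr !triE /Qform vE.
  by case: d01 => ->; ring.
have e0 : 0 <= 13%:Z * t + (u - h) + (v - h) + 2 * h.
  have := @jexp_ge0 13 1 (u - h) isT; have := @jexp_ge0 13 1 (v - h) isT.
  by have := @jexp_ge0 13 2 h isT; rewrite /t !mulrDr; lia.
rewrite ctripleE // -/t QE mulKz // tofracM.
have -> : (sgn (u - h + (v - h) + h))%:F = chi3 {fraction (fps int)} (d + 1).
  have -> : u - h + (v - h) + h = 2 * h + d by rewrite vE; ring.
  rewrite -sgnD sgnM2 mul1r /sgn /chi3.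
  by case: d01 => -> /=; rewrite ?expr1 ?tofracN ?tofrac1.
have x0 := fracX_neq0; rewrite -!mulrA; congr (_ * _).
rewrite tofracXn exprnP -!expfzDr //; congr (_ ^ _); rewrite gez0_abs //; ring.
Qed.

Let xq := qpoch_inf q q.

Lemma chain_sum (L : nat) :
  has_fps_sum (fun uv => theta_term 13 uv * bailey_kernel q (uv.1 - 1) (uv.2 - uv.1) L.+1 L.+1)
              (iter 3 (bailey_step q) (bailey_seed q) L L).
Proof.
have q0 : coef q 0 = 0 by [].
apply: has_fps_sum_fin; apply: (has_fsum_inj (h := FracField.tofrac (R := fps int))).
  exact: tofrac_inj.
have nroot n : (0 < n)%N -> q%:F ^+ n != 1.
  by have := @fracXn_nroot 1 isT n; rewrite expr1.
have two : 2%:R != 0 :> {fraction (fps int)}.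
  rewrite -(rmorph_nat (FracField.tofrac (R := fps int))) tofrac_eq0.
  by apply/eqP => /(congr1 (fun f => coef f 0)).
have := bailey_chain_sum fracX_neq0 nroot two L L.
rewrite -tofrac_bailey_chain //.
pose h (uv : int * int) := (uv.1 - 1, uv.2 - uv.1).
pose h' (k : int * int) := (k.1 + 1, k.2 + k.1 + 1).
have hK : cancel h h' by case=> u v; rewrite /h /h' /=; congr (_, _); ring.
have h'K : cancel h' h by case=> u v; rewrite /h /h' /=; congr (_, _); ring.
move=> /(has_fsum_reindex hK h'K); apply: eq_has_fsum => -[u v].
rewrite [RHS]/= tofracM tofrac_kernel // tofrac_theta_term /h /=.
by [].
Qed.

(** For fixed (u, v) the kernel has one q-factorial above and six below, each tending to (q)_oo. *)
Lemma chain_limit :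
  fps_cvg (fun L => iter 3 (bailey_step q) (bailey_seed q) L L)
    (qpoch_inf (q ^+ 13) (q ^+ 13) ^+ 2 * (qtheta int 1 13 ^+ 2 * qtheta int 2 13)
     * (xq * (xq^-1 * xq^-1) * (xq^-1 * xq^-1) * (xq^-1 * xq^-1))).
Proof.
have q0 : coef q 0 = 0 by [].
apply: (fps_tannery (c := fun uv L => bailey_kernel q (uv.1 - 1) (uv.2 - uv.1) L.+1 L.+1)
  (theta_sum (m := 13) isT) _ chain_sum) => -[u v] /=.
rewrite /bailey_kernel.
by repeat apply: fps_cvgM; try (apply: fps_cvg_qfact => // k; lia);
  apply: fps_cvg_qfactV => // N; exists (N + `|u| + `|v|)%N => k; lia.
Qed.

End ChainLimit.

(** * The multisum as a limit of the same chain *)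

Section LeftHandSide.
Local Notation q := (fpsX : fps int).
Let xq := qpoch_inf q q.
Let q0 : coef q 0 = 0. Proof. by []. Qed.

Definition A2_weight (rs : nat * nat) : fps int :=
  q ^+ (A2form rs.1 rs.2 + rs.1 + rs.2).

(** The cutoff encodes the ordering of consecutive summation indices, so that the sums run over all
    of [nat * nat]. *)
Definition step_weight (lm rs : nat * nat) : fps int :=
  if (rs.1 <= lm.1)%N && (rs.2 <= lm.2)%N
  then A2_weight rs / (qfact q (lm.1 - rs.1) * qfact q (lm.2 - rs.2)) else 0.

Lemma bailey_step_has_fsum (b : nat -> nat -> fps int) lm :
  has_fsum (fun rs => step_weight lm rs * b rs.1 rs.2) (bailey_step q b lm.1 lm.2).
Proof.
case: lm => L M; pose h (p : 'I_L.+1 * 'I_M.+1) : nat * nat := (val p.1, val p.2).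
have h_inj : injective h by case=> r s [r' s'] [] /val_inj-> /val_inj->.
exists (map h (index_enum _)); rewrite ?map_inj_uniq ?index_enum_uniq //.
split=> [[r s]|].
  rewrite /step_weight /=; case: ifP => [/andP[rL sM]|_ _]; last by rewrite mul0r.
  case/negP; apply/mapP; exists (Ordinal (rL : r < L.+1)%N, Ordinal (sM : s < M.+1)%N) => //.
  exact: mem_index_enum.
rewrite big_map /bailey_step pair_big /=; apply: eq_bigr => -[r s] _.
by rewrite /step_weight /= -ltnS ltn_ord -ltnS ltn_ord.
Qed.

Definition box (n : nat) : seq (nat * nat) := [seq (r, s) | r <- iota 0 n.+1, s <- iota 0 n.+1].

Lemma mem_box n rs : (rs \in box n) = (rs.1 <= n)%N && (rs.2 <= n)%N.
Proof.
case: rs => r s; apply/allpairsP/idP => [[[r' s']]|/andP[/= rn sn]].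
  by rewrite !mem_iota => -[/= ? ? [-> ->]]; lia.
by exists (r, s); split; rewrite ?inE ?mem_iota //=; lia.
Qed.

Lemma coef_A2_weight0 n rs (f : fps int) : rs \notin box n -> coef (A2_weight rs * f) n = 0.
Proof.
rewrite mem_box /A2_weight => rsn; apply: coef_XnM.
by case: rs rsn => r s /=; move: (A2form r s) => A; lia.
Qed.

Lemma chain_sum_exists (b : nat -> nat -> fps int) :
  exists S, has_fps_sum (fun rs => A2_weight rs * b rs.1 rs.2) S.
Proof.
apply: has_fps_sum_exists => n; exists (box n) => rs; exact: coef_A2_weight0.
Qed.

(** Termwise, 1/((q)_(L-r) (q)_(L-s)) tends to 1/(q)_oo^2. *)
Lemma bailey_step_limit (b : nat -> nat -> fps int) S :
  has_fps_sum (fun rs => A2_weight rs * b rs.1 rs.2) S ->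
  fps_cvg (fun L => bailey_step q b L L) (S * (xq^-1 * xq^-1)).
Proof.
move=> sumS; apply: (fps_tannery
    (c := fun rs L => qfactV q (L%:Z - rs.1%:Z) * qfactV q (L%:Z - rs.2%:Z)) sumS) => [rs|L].
  by apply: fps_cvgM; apply: fps_cvg_qfactV => // N; exists (N + rs.1 + rs.2)%N => k; lia.
apply: has_fps_sum_fin; apply: eq_has_fsum (bailey_step_has_fsum b (L, L)) => rs.
rewrite /step_weight /=; case: ifP => [/andP[rL sL]|rsL].
  by rewrite !subzn //= mulrAC -invrM ?qfact_unit // [qfact q (_ - rs.2) * _]mulrC.
suff : qfactV q (L%:Z - rs.1%:Z) * qfactV q (L%:Z - rs.2%:Z) = 0.
  by move=> ->; rewrite mulr0 mul0r.
have V0 (r : nat) : (L < r)%N -> qfactV q (L%:Z - r%:Z) = 0.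
  by rewrite -ltz_nat -subr_lt0; case: (L%:Z - r%:Z).
have [rL|/V0->] := leqP rs.1 L; last by rewrite mul0r.
by rewrite (V0 rs.2) ?mulr0 // ltnNge; move: rsL; rewrite rL /= => ->.
Qed.

(** The outermost step has no denominators: they became the factor 1/(q)_oo^2 in
    [bailey_step_limit]. *)
Definition chain_term (p : (nat * nat) * ((nat * nat) * (nat * nat))) : fps int :=
  A2_weight p.1 * (step_weight p.1 p.2.1
    * (step_weight p.2.1 p.2.2 * bailey_seed q p.2.2.1 p.2.2.2)).

Lemma step_weight0 n lm rs : lm \in box n -> rs \notin box n -> step_weight lm rs = 0.
Proof.
case: lm rs => [l m] [r s]; rewrite !mem_box /step_weight /= => /andP[? ?] rsn.
by case: ifP => // /andP[? ?]; case/negP: rsn; lia.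
Qed.

(** Indices decrease along the chain, so a box for the outermost pair also bounds the inner ones and
    the sixfold family is summable. Its sum is S by comparing fibres. *)
Lemma chain_term_sum S :
  has_fps_sum (fun rs => A2_weight rs * iter 2 (bailey_step q) (bailey_seed q) rs.1 rs.2) S ->
  has_fps_sum chain_term S.
Proof.
move=> sumS.
have inner0 n rs1 p : rs1 \in box n -> p \notin [seq (x, y) | x <- box n, y <- box n] ->
    step_weight rs1 p.1 * (step_weight p.1 p.2 * bailey_seed q p.2.1 p.2.2) = 0.
  case: p => rs2 rs3 rs1n nin; have [rs2n|/(step_weight0 rs1n)->] := boolP (rs2 \in box n);
    last by rewrite mul0r.
  have [rs3n|/(step_weight0 rs2n)->] := boolP (rs3 \in box n); last by rewrite mul0r mulr0.
  by case/negP: nin; apply/allpairsP; exists (rs2, rs3).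
have [|S' sumS'] := @has_fps_sum_exists _ _ chain_term.
  move=> n; exists [seq (x, y) | x <- box n, y <- [seq (x, y) | x <- box n, y <- box n]].
  case=> rs1 p nin; rewrite /chain_term.
  have [rs1n|] := boolP (rs1 \in box n); last exact: coef_A2_weight0.
  rewrite (inner0 n) ?mulr0 ?coef_fps0 //; apply: contra nin => pn.
  by apply/allpairsP; exists (rs1, p).
suff -> : S = S' by [].
apply: has_fps_sum_unique sumS _; apply: has_fps_sum_fiber sumS' _ => rs1.
apply: has_fps_sum_fin.
have rs1n : rs1 \in box (rs1.1 + rs1.2) by rewrite mem_box leq_addr leq_addl.
apply: (has_fsumZ (A2_weight rs1)).
apply: (has_fsum_pair (fun p => inner0 _ rs1 p rs1n)) (bailey_step_has_fsum _ rs1) => rs2.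
exact: (has_fsumZ (step_weight rs1 rs2) (bailey_step_has_fsum (bailey_seed q) rs2)).
Qed.

End LeftHandSide.

(** * The product side modulo 13 *)

Lemma prod_pairs13 (R : comNzRingType) (f : nat -> R) :
  \prod_(j < 13) f j.+1 = f 13%N * \prod_(1 <= i < 7) (f i * f (13 - i)%N).
Proof.
rewrite -(big_mkord xpredT (fun j => f j.+1)) unlock /= !subSS !subn0; ring.
Qed.

Lemma qpoch_inf_13 (q := fpsX : fps int) :
  qpoch_inf q q = qpoch_inf (q ^+ 13) (q ^+ 13) * \prod_(1 <= i < 7) qtheta int i 13.
Proof.
rewrite (qpoch_inf_dissect (d := 13)) //.
exact: (prod_pairs13 (fun j => qpoch_inf (q ^+ j) (q ^+ 13))).
Qed.

Lemma prod_sqr6 (R : comNzRingType) (f : nat -> R) :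
  (\prod_(1 <= i < 7) f i) ^+ 2
  = f 1%N ^+ 2 * f 2 * \prod_(i <- [:: 2; 3; 3; 4; 4; 5; 5; 6; 6]%N) f i.
Proof. by rewrite unlock /=; ring. Qed.

(** In (q)_oo^2 each theta(q^i), i = 1,...,6, occurs twice: the indices 1, 1, 2 belong to the theta
    series, the others to the stated product. *)
Lemma qpoch_inf_thetas (q := fpsX : fps int) :
  qpoch_inf (q ^+ 13) (q ^+ 13) ^+ 2 * (qtheta int 1 13 ^+ 2 * qtheta int 2 13)
  * qthetas int [:: 2; 3; 3; 4; 4; 5; 5; 6; 6]%N 13 = qpoch_inf q q ^+ 2.
Proof.
rewrite qpoch_inf_13 [RHS]exprMn -mulrA; congr (_ * _).
exact/esym/(prod_sqr6 (fun i => qtheta int i 13)).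
Qed.

(** The two limits give S = W / X^3, and W = X^2 / T. *)
Lemma cancel_limits (R : comUnitRingType) (W T X S : R) :
  X \is a GRing.unit -> T \is a GRing.unit -> W * T = X ^+ 2 ->
  W * (X * (X^-1 * X^-1) * (X^-1 * X^-1) * (X^-1 * X^-1)) = S * (X^-1 * X^-1) ->
  1 / X * (1 / T) = S.
Proof.
move=> /mulrV XV /mulrV TV; rewrite !div1r; move: X^-1 T^-1 XV TV => Y U XY TU WT WS.
transitivity (Y * U * (X * Y) ^+ 2); first by rewrite XY expr1n mulr1.
transitivity (W * Y ^+ 3 * (T * U)).
  by rewrite (_ : _ * (T * U) = W * T * (Y ^+ 3 * U)); [rewrite WT; ring | ring].
transitivity (W * (X * (Y * Y) * (Y * Y) * (Y * Y)) * X ^+ 2).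
  transitivity (W * Y ^+ 3 * (X * Y) ^+ 3); last by ring.
  by rewrite TU XY expr1n.
rewrite WS (_ : _ * X ^+ 2 = S * (X * Y) ^+ 2); last by ring.
by rewrite XY expr1n mulr1.
Qed.

Theorem theorem1p9 :
  let q : fps int := fpsX in
  fps_has_sum
    (fun '((r1, r2, r3), (s1, s2, s3)) =>
       [&& r1 >= r2, r2 >= r3, r3 >= 0, s1 >= s2, s2 >= s3 & s3 >= 0]%N)
    (fun '((r1, r2, r3), (s1, s2, s3)) =>
       q ^+ (A2form r1 s1 + A2form r2 s2 + A2form r3 s3
             + r1 + r2 + r3 + s1 + s2 + s3)
       / (qpoch q q (r1 - r2) * qpoch q q (r2 - r3) * qpoch q q r3
          * qpoch q q (s1 - s2) * qpoch q q (s2 - s3) * qpoch q q s3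
          * qpoch q q (r3 + s3 + 1)))
    (1 / qpoch_inf q q
     * (1 / qthetas int [:: 2; 3; 3; 4; 4; 5; 5; 6; 6]%N 13)).
Proof.
move=> q; apply: fps_has_sumE; have q0 : coef q 0 = 0 by [].
have [S sumS] := chain_sum_exists (iter 2 (bailey_step q) (bailey_seed q)).
have -> : 1 / qpoch_inf q q * (1 / qthetas int [:: 2; 3; 3; 4; 4; 5; 5; 6; 6]%N 13) = S.
  have uX : qpoch_inf q q \is a GRing.unit by apply: qpoch_inf_unit.
  have ut i : (0 < i < 13)%N -> qtheta int i 13 \is a GRing.unit.
    by move=> i13; rewrite fps_unitE coef0_qtheta ?unitr1.
  have uT : qthetas int [:: 2; 3; 3; 4; 4; 5; 5; 6; 6]%N 13 \is a GRing.unit.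
    have /allP i13 : all (fun i => 0 < i < 13)%N [:: 2; 3; 3; 4; 4; 5; 5; 6; 6]%N by [].
    by rewrite /qthetas big_seq; apply: rpred_prod => i /i13 /ut.
  (* The third Bailey step, on the diagonal L = M, has two descriptions of its limit. *)
  have lim := fps_cvg_unique chain_limit (bailey_step_limit sumS).
  exact: cancel_limits uX uT qpoch_inf_thetas lim.
have := chain_term_sum sumS.
pose h (p : (nat * nat * nat) * (nat * nat * nat)) :=
  let: ((r1, r2, r3), (s1, s2, s3)) := p in ((r1, s1), ((r2, s2), (r3, s3))).
pose h' (p : (nat * nat) * ((nat * nat) * (nat * nat))) :=
  let: ((r1, s1), ((r2, s2), (r3, s3))) := p in ((r1, r2, r3), (s1, s2, s3)).
have hK : cancel h h' by case=> -[[r1 r2] r3] [[s1 s2] s3].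
have h'K : cancel h' h by case=> -[r1 s1] [[r2 s2] [r3 s3]].
move=> /(has_fps_sum_reindex hK h'K); apply: eq_has_fps_sum.
case=> -[[r1 r2] r3] [[s1 s2] s3]; rewrite /h /chain_term /step_weight /= !andbT.
(* If an inequality fails, a cutoff in [step_weight] vanishes, in agreement with the summation
   condition. *)
have [rs1|] := boolP ((r2 <= r1) && (s2 <= s1))%N; last first.
  move=> /nandP[] /negPf->; first by rewrite !(mul0r, mulr0).
  by rewrite !andbF !(mul0r, mulr0).
have [rs2|] := boolP ((r3 <= r2) && (s3 <= s2))%N; last first.
  move=> /nandP[] /negPf->; first by rewrite !(andbF, mul0r, mulr0).
  by rewrite !(andbF, mul0r, mulr0).
case/andP: rs1 => -> ->; case/andP: rs2 => -> -> /=.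
rewrite /bailey_seed /A2_weight !qpochE /= addn1.
rewrite !invrM ?unitrM ?qfact_unit //.
rewrite (_ : (_ + _ + _ + r1 + _ + _ + _ + _ + _)%N = (A2form r1 s1 + r1 + s1) +
  ((A2form r2 s2 + r2 + s2) + (A2form r3 s3 + r3 + s3)))%N; last by lia.
by rewrite !exprD; ring.
Qed.
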